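(* Equip $\mathcal{X}$ either with the box topology or with the concentration topology. Then the $\mathbb{R}_+$-action on $\mathcal{X}_*$, together with the quotient map $\pi\colon\mathcal{X}_*\to\Sigma$, is a locally trivial principal $\mathbb{R}_+$-bundle over $\Sigma$, and this bundle is nontrivial.
   Context: An mm-space is a triple $(X,d_X,\mu_X)$ where $(X,d_X)$ is a complete separable metric space and $\mu_X$ is a Borel probability measure on $X$. Two mm-spaces are mm-isomorphic if there is a measure-preserving isometry between the supports of their measures. $\mathcal{X}$ is the set of mm-isomorphism classes, and every mm-space is assumed to satisfy $X=\operatorname{supp}\mu_X$. Let $I=[0,1)$ with Lebesgue measure $\mathcal{L}^1$. A parameter of $X$ is a Borel map $\varphi\colon I\to X$ with $\varphi_*\mathcal{L}^1=\mu_X$. The box distance $\square(X,Y)$ is the infimum of $\varepsilon\ge0$ such that there exist parameters $\varphi$ of $X$, $\psi$ of $Y$ and a Borel set $I_0\subset I$ with $\mathcal{L}^1(I_0)\ge1-\varepsilon$ and $|d_X(\varphi(s),\varphi(t))-d_Y(\psi(s),\psi(t))|\le\varepsilon$ for all $s,t\in I_0$. It induces the box topology. The Ky Fan metric is $d_{KF}(f,g)=\inf\{\varepsilon\ge0:\mathcal{L}^1(|f-g|>\varepsilon)\le\varepsilon\}$. The observable distance $d_{\mathrm{conc}}(X,Y)$ is the infimum over parameters $\varphi,\psi$ of the $d_{KF}$-Hausdorff distance between $\{f\circ\varphi : f\text{ 1-Lipschitz on }X\}$ and $\{g\circ\psi : g\text{ 1-Lipschitz on }Y\}$. It induces the concentration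 topology. $\mathbb{R}_+=(0,\infty)$ acts on $\mathcal{X}$ by $tX=(X,t\,d_X,\mu_X)$. Set $\mathcal{X}_*=\mathcal{X}\setminus\{*\}$, where $*$ is the one-point space, and $\Sigma=\mathcal{X}_*/\mathbb{R}_+$ with the quotient topology and quotient map $\pi$. A free $\mathbb{R}_+$-action on a space $E$ with quotient map $\pi\colon E\to B=E/\mathbb{R}_+$ is a principal $\mathbb{R}_+$-bundle if the translation function $\tau\colon\{(e,e')\in E\times E:\pi(e)=\pi(e')\}\to\mathbb{R}_+$, defined by $e'=\tau(e,e')e$, is continuous. It is locally trivial if $B$ has an open cover by sets $U$ admitting $\mathbb{R}_+$-equivariant homeomorphisms $\pi^{-1}(U)\cong U\times\mathbb{R}_+$ over $U$. It is trivial if such a homeomorphism exists with $U=B$. *)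

(* Defs.v *)
From HB Require Import structures.
From mathcomp Require Import all_boot all_order all_algebra.
From mathcomp Require Import all_classical all_reals all_analysis.
Set Implicit Arguments. Unset Strict Implicit. Unset Printing Implicit Defensive.
Import Order.TTheory GRing.Theory Num.Theory.
Local Open Scope classical_set_scope.
Local Open Scope ring_scope.

Section MM.
Variable R : realType.

Definition mball (T : Type) (d : T -> T -> R) (x : T) (r : R) : set T :=
  [set y | d x y < r].

Definition mopen (T : Type) (d : T -> T -> R) (U : set T) : Prop :=
  forall x, U x -> exists2 r : R, 0 < r & mball d x r `<=` U.

Definition mborel (T : Type) (d : T -> T -> R) : set (set T) :=
  <<s mopen d >>.

Record mmspace := MMSpace {
  mcar : Type;
  mdist : mcar -> mcar -> R;
  mdist_refl : forall x, mdist x x = 0;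
  mdist_sep : forall x y, mdist x y = 0 -> x = y;
  mdist_sym : forall x y, mdist x y = mdist y x;
  mdist_tri : forall x y z, mdist x z <= mdist x y + mdist y z;
  mcomplete : forall u : nat -> mcar,
    (forall e : R, 0 < e -> exists N, forall m n, (N <= m)%N -> (N <= n)%N ->
        mdist (u m) (u n) < e) ->
    exists l, forall e : R, 0 < e -> exists N, forall n, (N <= n)%N ->
        mdist (u n) l < e;
  mseparable : exists D : nat -> mcar,
    forall x (e : R), 0 < e -> exists n, mdist x (D n) < e;
  mmeas : set mcar -> R;
  mmeas_ge0 : forall A, mborel mdist A -> 0 <= mmeas A;
  mmeas0 : mmeas set0 = 0;
  mmeasT : mmeas setT = 1;
  mmeas_sigma_additive : forall F : nat -> set mcar,
    (forall n, mborel mdist (F n)) ->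
    (forall m n, m <> n -> F m `&` F n = set0) ->
    forall e : R, 0 < e -> exists N, forall n, (N <= n)%N ->
      `| \sum_(0 <= k < n) mmeas (F k) - mmeas (\bigcup_k F k) | < e;
  msupp : forall x (r : R), 0 < r -> 0 < mmeas (mball mdist x r)
}.

(* mm-isomorphism: measure-preserving isometry (onto, since supports are
   the whole spaces) *)
Definition mm_iso (X Y : mmspace) : Prop :=
  exists f : mcar X -> mcar Y,
    (forall y, exists x, f x = y) /\
    (forall x x', mdist (f x) (f x') = mdist x x') /\
    (forall B, mborel (@mdist Y) B -> @mmeas Y B = @mmeas X (f @^-1` B)).

Definition cls (X : mmspace) : set mmspace := [set Y | mm_iso X Y].

Definition isClass (A : set mmspace) : Prop := exists X, A = cls X.

Definition is_point (X : mmspace) : Prop := forall x y : mcar X, x = y.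

Definition Estar (A : set mmspace) : Prop :=
  isClass A /\ ~ (exists X, A X /\ is_point X).

Definition I01 : set R := `[0, 1[.

Definition leb : set R -> \bar R := @lebesgue_measure R.

Definition param (X : mmspace) (phi : R -> mcar X) : Prop :=
  forall B, mborel (@mdist X) B ->
    measurable (I01 `&` phi @^-1` B) /\
    leb (I01 `&` phi @^-1` B) = (@mmeas X B)%:E.

Definition boxdist (X Y : mmspace) : R :=
  inf [set e : R | 0 <= e /\
    exists (phi : R -> mcar X) (psi : R -> mcar Y) (I0 : set R),
      [/\ param phi, param psi, measurable I0 /\ I0 `<=` I01,
          ((1 - e)%:E <= leb I0)%E &
          forall s t, I0 s -> I0 t ->
            `| mdist (phi s) (phi t) - mdist (psi s) (psi t) | <= e]].

Definition kyfan (f g : R -> R) : R :=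
  inf [set e : R | 0 <= e /\
    (leb (I01 `&` [set t : R | (e < `| f t - g t |)%R]) <= e%:E)%E].

Definition lip1 (X : mmspace) (phi : R -> mcar X) : set (R -> R) :=
  [set f | exists u : mcar X -> R,
     (forall x y, `| u x - u y | <= mdist x y) /\ f = u \o phi].

Definition hausdorff_kf (A B : set (R -> R)) : R :=
  Num.max (sup [set inf [set kyfan f g | g in B] | f in A])
          (sup [set inf [set kyfan f g | f in A] | g in B]).

Definition concdist (X Y : mmspace) : R :=
  inf [set e : R | exists (phi : R -> mcar X) (psi : R -> mcar Y),
     [/\ param phi, param psi & e = hausdorff_kf (lip1 phi) (lip1 psi)]].

Definition clsdist (delta : mmspace -> mmspace -> R) (A B : set mmspace) : R :=
  inf [set delta X Y | X in A & Y in B].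

Definition openX (delta : mmspace -> mmspace -> R)
    (U : set (set mmspace)) : Prop :=
  U `<=` isClass /\
  forall A, U A -> exists2 r : R, 0 < r &
    forall A', isClass A' -> clsdist delta A A' < r -> U A'.

(* [mm_iso_scaled t X Y] : Y is mm-isomorphic to tX = (X, t d_X, mu_X),
   written out directly (tX has the same Borel sets and measure as X). *)
Definition mm_iso_scaled (t : R) (X Y : mmspace) : Prop :=
  exists f : mcar X -> mcar Y,
    (forall y, exists x, f x = y) /\
    (forall x x', mdist (f x) (f x') = t * mdist x x') /\
    (forall B, mborel (@mdist Y) B -> @mmeas Y B = @mmeas X (f @^-1` B)).

Definition actC (t : R) (A : set mmspace) : set mmspace :=
  [set Y | exists2 X, A X & mm_iso_scaled t X Y].

Definition piS (A : set mmspace) : set (set mmspace) :=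
  [set A' | exists2 t : R, 0 < t & A' = actC t A].

Definition Sigma (b : set (set mmspace)) : Prop :=
  exists2 A, Estar A & b = piS A.

Definition ropen (W : set R) : Prop :=
  forall x, W x -> exists2 e : R, 0 < e & forall y, `| y - x | < e -> W y.

Definition prod_open (A B : Type) (oA : set A -> Prop) (oB : set B -> Prop)
    (W : set (A * B)) : Prop :=
  forall p, W p -> exists U V, [/\ oA U, oB V, U p.1, V p.2 &
     forall a b, U a -> V b -> W (a, b)].

(* continuity of f restricted to the subspace D of (A, oA), with values in
   (B, oB) (equivalently in any subspace of B containing f(D)) *)
Definition cont_on (A B : Type) (oA : set A -> Prop) (D : set A)
    (oB : set B -> Prop) (f : A -> B) : Prop :=
  forall V, oB V -> exists U, oA U /\ forall x, D x -> (U x <-> V (f x)).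

Definition openS (delta : mmspace -> mmspace -> R)
    (W : set (set (set mmspace))) : Prop :=
  W `<=` Sigma /\
  exists U, openX delta U /\ forall e, Estar e -> (U e <-> W (piS e)).

Definition free_action : Prop :=
  forall e, Estar e -> forall t : R, 0 < t -> actC t e = e -> t = 1.

Definition fiber_pairs (p : set mmspace * set mmspace) : Prop :=
  [/\ Estar p.1, Estar p.2 & piS p.1 = piS p.2].

Definition translation_continuous (delta : mmspace -> mmspace -> R) : Prop :=
  exists tau : set mmspace * set mmspace -> R,
    (forall p, fiber_pairs p -> 0 < tau p /\ p.2 = actC (tau p) p.1) /\
    cont_on (prod_open (openX delta) (openX delta)) fiber_pairs ropen tau.

Definition principal_bundle (delta : mmspace -> mmspace -> R) : Prop :=
  free_action /\ translation_continuous delta.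

Definition trivialization (delta : mmspace -> mmspace -> R)
    (U : set (set (set mmspace))) : Prop :=
  let D := [set e | Estar e /\ U (piS e)] in
  let D' := [set p : set (set mmspace) * R | U p.1 /\ 0 < p.2] in
  exists (h : set mmspace -> set (set mmspace) * R)
         (g : set (set mmspace) * R -> set mmspace),
  [/\ (forall e, D e -> D' (h e)),
      (forall p, D' p -> D (g p)),
      (forall e, D e -> g (h e) = e) &
      (forall p, D' p -> h (g p) = p)] /\
  [/\ cont_on (openX delta) D (prod_open (openS delta) ropen) h,
      cont_on (prod_open (openS delta) ropen) D' (openX delta) g,
      (forall e, D e -> (h e).1 = piS e) &
      (forall e (t : R), D e -> 0 < t -> h (actC t e) = ((h e).1, t * (h e).2))].

Definition locally_trivial (delta : mmspace -> mmspace -> R) : Prop :=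
  forall b, Sigma b -> exists U, [/\ openS delta U, U b & trivialization delta U].

Definition trivial_bundle (delta : mmspace -> mmspace -> R) : Prop :=
  trivialization delta Sigma.

Definition nontrivial_loc_trivial_principal_bundle
    (delta : mmspace -> mmspace -> R) : Prop :=
  [/\ principal_bundle delta, locally_trivial delta & ~ trivial_bundle delta].

End MM.

(* Main.v *)
(* The key invariant is a scale. Call [k, r] admissible for X if some 1-Lipschitz function on X
   deviates by more than r from every constant on a set of measure more than k. The supremum
   [msize a X] of (k - a) r over admissible pairs with k >= a is homogeneous of degree one under
   scaling, and it is continuous for both topologies because closeness of observables moves both k
   and r by at most epsilon (box closeness implies closeness of observables, by McShane extension).
   It is positive for small a unless X is a point, so on {msize a > 0} it yields a chart, and
   quotients of sizes compute the translation function. The inverse of the chart is continuous by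
   a tube argument over a compact interval of scales, so the triangle inequality for the two
   distances is never needed.

   Both distances are infima over parameters, so parameters must be shown to exist: refine
   countable partitions of X into cells of small diameter, and match them with nested intervals
   of the same length in [0,1).

   A trivialization would give a continuous homogeneous F > 0. Take two points of mass 1/2 at
   distance 1 and attach to one of them a far point of small mass q at distance L. By continuity F
   stays bounded whatever L is; but rescaling by 1/L converges to the two-point space with masses
   q and 1 - q, so F of the rescaled space, which is O(1/L), would tend to a positive limit. *)
Require Import Defs.
From HB Require Import structures.
From mathcomp Require Import all_boot all_order all_algebra.
From mathcomp Require Import all_classical all_reals all_analysis.
From mathcomp Require Import ring lra.
(* Imported again because mathcomp-analysis has its own [mdist]. *)
Import Defs.
Set Implicit Arguments. Unset Strict Implicit. Unset Printing Implicit Defensive.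
Import Order.TTheory GRing.Theory Num.Theory numFieldNormedType.Exports.
Local Open Scope classical_set_scope.
Local Open Scope ring_scope.

(** * Measures of mm-spaces *)

Section MeasureOfSpace.
Context {R : realType}.
Implicit Types X Y : mmspace R.

Lemma mcar_inhabited X : exists x : mcar X, True.
Proof.
apply: contrapT => h.
have: @setT (mcar X) = set0 by apply/seteqP; split=> x //= _; apply: h; exists x.
move=> e; have := mmeasT X; rewrite e mmeas0 => /esym/eqP; by rewrite oner_eq0.
Qed.

(** An alias that carries the choice and pointed structures a measurable type requires. *)
Definition pts X : Type := mcar X.
HB.instance Definition _ X := gen_eqMixin (pts X).
HB.instance Definition _ X := gen_choiceMixin (pts X).
HB.instance Definition _ X :=
  isPointed.Build (pts X) (projT1 (cid (mcar_inhabited X))).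

Definition borel X := g_sigma_algebraType (mopen (@mdist R X) : set (set (pts X))).
HB.instance Definition _ X := Measurable.on (borel X).

(** [mmeas] is arbitrary off the Borel sets; the value 0 there makes nonnegativity and finiteness
    hold on all sets. *)
Definition mu X (A : set (borel X)) : \bar R :=
  if `[< mborel (@mdist R X) A >] then (mmeas A)%:E else 0%E.

Lemma muE X (A : set (borel X)) : measurable A -> mu A = (mmeas A)%:E.
Proof. by move=> mA; rewrite /mu asboolT. Qed.

Lemma mu_set0 X : mu (set0 : set (borel X)) = 0%E.
Proof. by rewrite muE// mmeas0. Qed.

Lemma mu_ge0 X (A : set (borel X)) : (0 <= mu A)%E.
Proof.
by rewrite /mu; case: asboolP => // mA; rewrite lee_fin mmeas_ge0.
Qed.

Lemma mu_sigma X : semi_sigma_additive (@mu X).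
Proof.
move=> F mF tF mUF.
rewrite muE//.
rewrite (_ : (fun n => _) = EFin \o (fun n => \sum_(0 <= i < n) mmeas (F i))); last first.
  by apply/funext => n /=; rewrite -sumEFin; apply: eq_bigr => i _; rewrite muE.
apply: cvg_EFin.
  by apply: nearW.

apply/cvgrPdist_lt => e e0.
have [|N HN] := @mmeas_sigma_additive R X F mF _ e e0.
  move=> m n mn; apply/eqP; apply: contrapT => /negP/set0P[x [xm xn]].
  by apply: mn; apply: tF => //; exists x.
exists N => // n /= Nn; rewrite distrC; exact: HN.
Qed.

HB.instance Definition _ X := isMeasure.Build _ _ _ (@mu X)
  (@mu_set0 X) (@mu_ge0 X) (@mu_sigma X).

Lemma mu_setT X : mu (setT : set (borel X)) = 1%E.
Proof. by rewrite muE// mmeasT. Qed.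

Lemma fin_mu X (A : set (borel X)) : mu A \is a fin_num.
Proof. by rewrite /mu; case: ifP. Qed.

Lemma mu_le1 X (A : set (borel X)) : (mu A <= 1)%E.
Proof.
rewrite /mu; case: asboolP => // mA; rewrite -(muE mA) -(mu_setT X).
by apply: le_measure; rewrite ?inE.
Qed.

Lemma mopen_borel X (A : set (borel X)) : mopen (@mdist R X) A -> measurable A.
Proof. exact: sub_gen_smallest. Qed.

Lemma mopen_ball X x r : mopen (@mdist R X) (mball (@mdist R X) x r).
Proof.
move=> y xy; exists (r - mdist x y); rewrite ?subr_gt0//= => z yz.
rewrite /mball/=; apply: le_lt_trans (mdist_tri x y z) _.
by rewrite -ltrBrDl.
Qed.
Local Hint Resolve mopen_ball : core.

Lemma measurable_ball X x r : measurable (mball (@mdist R X) x r : set (borel X)).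
Proof. exact: mopen_borel. Qed.

Lemma mdist_ge0 X (x y : mcar X) : 0 <= mdist x y.
Proof.
have := mdist_tri x y x; rewrite mdist_refl (mdist_sym y x) => h.
by lra.
Qed.

(** On arbitrary sets [leb] is the Lebesgue outer measure, so deviation sets can be estimated
    whether measurable or not. *)
Lemma leb_mono (A B : set R) : A `<=` B -> (leb A <= leb B)%E.
Proof. exact: (@le_mu_ext _ _ R (wlength idfun)). Qed.

Lemma lebU (A B : set R) : (leb (A `|` B) <= leb A + leb B)%E.
Proof.
exact: (@outer_measureU2 _ R ((wlength (idfun : R -> R))^*%mu)).
Qed.

Lemma leb_ge0 (A : set R) : (0 <= leb A)%E.
Proof. exact: measure_ge0. Qed.

Lemma leb_I01 : leb (I01 (R:=R)) = 1%E.
Proof. by rewrite /leb /I01 lebesgue_measure_itv/= lte_fin ltr01 oppr0 adde0. Qed.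

Lemma measurable_I01 : measurable (I01 (R:=R)).
Proof. exact: measurable_itv. Qed.

End MeasureOfSpace.

(** * Existence of parameters *)

(** The preimage of [S] is a countable disjoint union of fibers. The series depends on [f] only
    through the masses of its fibers, so two maps can be compared term by term. *)
Lemma measure_fibers d (T : measurableType d) (R : realType)
  (m : {measure set T -> \bar R}) (W : countType) (f : T -> W) (D : set T)
  (S : set W) : (forall w, measurable (D `&` [set t | f t = w])) ->
  measurable (D `&` [set t | S (f t)]) /\
  m (D `&` [set t | S (f t)]) =
  (\sum_(0 <= i <oo) if @pickle_inv W i is Some w then
     if `[< S w >] then m (D `&` [set t | f t = w]) else 0 else 0)%E.
Proof.
move=> mD.
pose F i := if @pickle_inv W i is Some w then
  if `[< S w >] then D `&` [set t | f t = w] else set0 else set0.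
have mF i : measurable (F i).
  by rewrite /F; case: pickle_inv => // w; case: asboolP.
have tF : trivIset setT F.
  move=> i j _ _ [t []]; rewrite /F.
  case ei: (@pickle_inv W i) => [w|]//; case: asboolP => // _ [_ /= tw].
  case ej: (@pickle_inv W j) => [w'|]//; case: asboolP => // _ [_ /= tw'].
  have := @pickle_invK W i; have := @pickle_invK W j.
  by rewrite ei ej /= -tw -tw' => <- <-.
have DE : D `&` [set t | S (f t)] = \bigcup_i F i.
  apply/seteqP; split=> [t [Dt St]|t [i _]].
    by exists (pickle (f t)) => //; rewrite /F pickleK_inv asboolT.
  by rewrite /F; case: pickle_inv => // w; case: asboolP => // Sw [Dt /= tw]; split=> //=; rewrite tw.
rewrite DE; split; first exact: bigcup_measurable.
rewrite measure_semi_bigcup//; last exact: bigcup_measurable.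
apply: eq_eseriesr => i _; rewrite /F.
by case: pickle_inv => // w; case: asboolP.
Qed.

Section ParamExistence.
Context {R : realType} (X : mmspace R).

(** * Nested countable partitions of the space *)

Let D : nat -> mcar X := projT1 (cid (mseparable X)).
Let r (n : nat) : R := 2^-1 ^+ n.
(** Balls of radius 2^-n about the dense sequence, made disjoint: the partition of level [n]. *)
Let A n : nat -> set (borel X) := seqDU (fun k => mball (@mdist R X) (D k) (r n)).

Let r_gt0 n : 0 < r n. Proof. by rewrite exprn_gt0. Qed.

Let rS n : r n.+1 = r n / 2. Proof. by rewrite /r exprS mulrC. Qed.

Let r_small (e : R) : 0 < e -> exists N, forall n, (N <= n)%N -> r n < e.
Proof.
move=> e0.
have : (r @ \oo --> (0 : R)) by apply: cvg_expr; rewrite ger0_norm ?invr_ge0// invf_lt1// ltr1n.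
move/cvgrPdist_lt/(_ e e0) => [N _ HN]; exists N => n /HN /=.
by rewrite sub0r normrN ger0_norm// ltW.
Qed.

Let A_cover n x : exists k, A n k x.
Proof.
have [k hk] := projT2 (cid (mseparable X)) x (r n) (r_gt0 n).
have : (\bigcup_k A n k) x.
  by rewrite /A -seqDU_bigcup_eq; exists k => //=; rewrite /mball/= mdist_sym.
by move=> [j _ Aj]; exists j.
Qed.

Let A_uniq n x j k : A n j x -> A n k x -> j = k.
Proof.
by move=> Aj Ak; apply: (@trivIset_seqDU _ (fun k => mball (@mdist R X) (D k) (r n)) j k) => //; exists x.
Qed.

Let A_ball n k x : A n k x -> mdist (D k) x < r n.
Proof. by move=> h; have := @subset_seqDU _ _ _ _ h. Qed.

Let measurable_A n k : measurable (A n k).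
Proof.
by apply: seqDU_measurable => i; exact: measurable_ball.
Qed.

(** Words list the finest level first, so [k] is an index of level [size w']. *)
Fixpoint cell (w : seq nat) : set (borel X) :=
  if w is k :: w' then cell w' `&` A (size w') k else setT.

Let measurable_cell w : measurable (cell w).
Proof. by elim: w => [|k w IH]//=; exact: measurableI. Qed.

Let m w : R := mmeas (cell w).

Let m_ge0 w : 0 <= m w. Proof. by apply: mmeas_ge0; exact: measurable_cell. Qed.

(** * Nested intervals with the masses of the cells *)

Let psum w n := \sum_(0 <= j < n) m (j :: w).

Let psumS w n : psum w n.+1 = psum w n + m (n :: w).
Proof. by rewrite /psum big_nat_recr. Qed.

Let psum_homo w : {homo psum w : i j / (i <= j)%N >-> i <= j}.
Proof.
by apply/nondecreasing_seqP => n; rewrite psumS lerDl.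
Qed.

(** The children of a cell partition it, so countable additivity applies. *)
Let psum_cvg w : psum w @ \oo --> m w.
Proof.
have : (\sum_(0 <= j < n) mu (cell (j :: w)))%E @[n --> \oo] --> mu (cell w).
  have -> : cell w = \bigcup_j cell (j :: w).
    apply/seteqP; split => [x wx|x [j _ []//]].
    by have [k Ak] := A_cover (size w) x; exists k.
  apply: measure_semi_sigma_additive.
  - by move=> j; exact: measurable_cell.
  - move=> i j _ _ [x [[_ xi] [_ xj]]]; exact: A_uniq xi xj.
  - by apply: bigcup_measurable => j _; exact: measurable_cell.
rewrite (muE (measurable_cell _)) => /fine_cvgP[_]; rewrite (_ : fine \o _ = psum w)//.
apply/funext => n; rewrite /comp (eq_bigr (fun j => (m (j :: w))%:E)) => [|j _].
  by rewrite sumEFin.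
exact: (muE (measurable_cell (j :: w))).
Qed.

Let psum_le w n : psum w n <= m w.
Proof.
rewrite -(cvg_lim (@Rhausdorff R) (@psum_cvg w)).
apply: nondecreasing_cvgn_le; first exact: psum_homo.
by apply/cvg_ex; exists (m w); exact: psum_cvg.
Qed.

(** Left endpoint of the interval of a word: the children are laid side by side inside the parent,
    in the order of their indices. *)
Fixpoint lo (w : seq nat) : R := if w is k :: w' then lo w' + psum w' k else 0.

(** Half-open, so that the children tile the parent and a cell of mass 0 gets the empty interval. *)
Let J w : set R := `[lo w, lo w + m w[.

Let J_ge w t : J w t -> lo w <= t. Proof. by rewrite /J/= in_itv/= => /andP[]. Qed.

Let J_lt w t : J w t -> t < lo w + m w.
Proof. by rewrite /J/= in_itv/= => /andP[]. Qed.

Let JP w t : lo w <= t -> t < lo w + m w -> J w t.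
Proof. by move=> *; rewrite /J/= in_itv/=; apply/andP. Qed.

Let J_tail k w t : J (k :: w) t -> J w t.
Proof.
move=> Jt; have := J_ge Jt; have := J_lt Jt; rewrite /= => h1 h2.
apply: JP.
  by apply: le_trans h2; rewrite lerDl -(_ : psum w 0 = 0) ?psum_homo// /psum big_geq.
by apply: lt_le_trans h1 _; rewrite -addrA -psumS lerD2l psum_le.
Qed.

Let J_head w t : J w t -> exists k, J (k :: w) t.
Proof.
move=> Jt.
have : exists n, t - lo w < psum w n.
  have h : 0 < m w - (t - lo w) by have := J_lt Jt; lra.
  have /cvgrPdist_lt/(_ _ h)[N _ /(_ N (leqnn N))] := @psum_cvg w.
  rewrite ger0_norm ?subr_ge0 ?psum_le// => h'; exists N; lra.
move=> ex; have [n hn minn] := ex_minnP ex.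
(* The least such [n] is positive because the empty sum is 0; its predecessor is the child that
   contains [t]. *)
case: n hn minn => [|n] hn minn.
  by move: hn; rewrite /psum big_geq//; have := J_ge Jt; lra.
exists n; apply: JP => /=.
  rewrite leNgt; apply/negP => h.
  suff /minn : t - lo w < psum w n by rewrite ltnn.
  by lra.
by move: hn; rewrite psumS; lra.
Qed.

Let J_uniq_le w t j k : J (j :: w) t -> J (k :: w) t -> (k <= j)%N.
Proof.
move=> Jj Jk; rewrite leqNgt; apply/negP => jk.
have := J_lt Jj; have := J_ge Jk; rewrite /= -addrA -psumS.
by have := @psum_homo w _ _ jk; lra.
Qed.

Let J_uniq w t j k : J (j :: w) t -> J (k :: w) t -> j = k.
Proof.
by move=> Jj Jk; apply/eqP; rewrite eqn_leq (J_uniq_le Jj Jk) (J_uniq_le Jk Jj).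
Qed.

(** * Coding times and points by words *)

Let K w t : nat := xget 0%N [set k | J (k :: w) t].
Let xK n x : nat := xget 0%N [set k | A n k x].

Fixpoint tword n t := if n is n'.+1 then K (tword n' t) t :: tword n' t else [::].
Fixpoint xword n x := if n is n'.+1 then xK n' x :: xword n' x else [::].

Let JK w t : J w t -> J (K w t :: w) t.
Proof. by move=> /J_head[k Jk]; apply: (@xgetPex _ 0%N [set k | J (k :: w) t]); exists k. Qed.

Let AxK n x : A n (xK n x) x.
Proof. by have [k Ak] := A_cover n x; apply: (@xgetPex _ 0%N [set k | A n k x]); exists k. Qed.

Let size_tword n t : size (tword n t) = n.
Proof. by elim: n => //= n ->. Qed.

Let size_xword n t : size (xword n t) = n.
Proof. by elim: n => //= n ->. Qed.

Let J_nil t : J [::] t = I01 t.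
Proof. by rewrite /J /m /= mmeasT add0r. Qed.

Let J_tword n t : I01 t -> J (tword n t) t.
Proof.
by move=> It; elim: n => [|n IH]; rewrite ?J_nil//; exact: JK.
Qed.

Let cell_xword n x : cell (xword n x) x.
Proof. by elim: n => //= n IH; split => //; rewrite size_xword; exact: AxK. Qed.

Let J_sub w t : J w t -> I01 t.
Proof. by elim: w => [|k w IH]; [rewrite J_nil | move=> /J_tail]. Qed.

Let tword_eq w t : J w t -> tword (size w) t = w.
Proof.
elim: w => //= k w IH Jt; have Jw := J_tail Jt.
by rewrite IH//; congr (_ :: _); apply: J_uniq (JK Jw) Jt.
Qed.

Let xword_eq w x : cell w x -> xword (size w) x = w.
Proof.
by elim: w => //= k w IH [cw Ak]; rewrite IH//; congr (_ :: _); apply: A_uniq (AxK _ _) Ak.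
Qed.

Let tfiber n w : @I01 R `&` [set t | tword n t = w] = if size w == n then J w else set0.
Proof.
apply/seteqP; split => [t [It /= <-]|t].
  by rewrite size_tword eqxx; exact: J_tword.
by case: eqP => // <- Jt; split; [exact: J_sub Jt|exact: tword_eq].
Qed.

Let xfiber n w : setT `&` [set x | xword n x = w] = if size w == n then cell w else set0.
Proof.
apply/seteqP; split => [x [_ /= <-]|x].
  by rewrite size_xword eqxx; exact: cell_xword.
by case: eqP => // <- Jt; split => //; exact: xword_eq.
Qed.

Let leb_J w : leb (J w) = (m w)%:E.
Proof.
rewrite /leb /J lebesgue_measure_itv/= lte_fin ltrDl -EFinB.
case: ltP => h; first by congr EFin; ring.
by congr EFin; apply/eqP; rewrite eq_le h m_ge0.
Qed.

(** For a word [w] of length [n] the fibers are [J w] and [cell w], both of measure [m w]; so the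
    two codings have the same law. *)
Let word_measure n (S : set (seq nat)) :
  [/\ measurable (@I01 R `&` [set t | S (tword n t)]),
      measurable ([set x | S (xword n x)] : set (borel X)) &
      leb (@I01 R `&` [set t | S (tword n t)]) =
      mu ([set x | S (xword n x)] : set (borel X))].
Proof.
have mt w : measurable (@I01 R `&` [set t | tword n t = w]).
  by rewrite tfiber; case: ifP => // _; exact: measurable_itv.
have mx w : measurable (setT `&` [set x | xword n x = w] : set (borel X)).
  by rewrite xfiber; case: ifP.
have [t1 t2] := measure_fibers (@lebesgue_measure R) S mt.
have [x1 x2] := measure_fibers (@mu R X) S mx.
rewrite setTI in x1 x2; split => //; rewrite x2 [LHS]t2.
apply: eq_eseriesr => i _; case: pickle_inv => // w; case: ifP => // _.
rewrite tfiber xfiber; case: ifP => // _; last by rewrite !measure0.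
rewrite [LHS]leb_J; exact: esym (muE (measurable_cell w)).
Qed.


Let cell_A n t y i : cell (tword n t) y -> (i < n)%N -> A i (K (tword i t) t) y.
Proof.
elim: n => //= n IH [cy Ay]; rewrite ltnS leq_eqVlt => /orP[/eqP->|/IH]; last exact.
by rewrite size_tword in Ay.
Qed.

(** The interval of the word contains [t], hence has positive length, which is the mass of the
    cell. *)
Let cell_tword_nonempty n t : I01 t -> exists y, cell (tword n t) y.
Proof.
move=> It; apply: contrapT => h.
have e : cell (tword n t) = set0 by apply/seteqP; split => // y cy; apply: h; exists y.
have m0 : m (tword n t) = 0 by rewrite /m e; exact: mmeas0.
by have := J_ge (J_tword n It); have := J_lt (J_tword n It); rewrite m0; lra.
Qed.

(** * The parameter as a limit of centers *)

Let center n (t : R) : mcar X := D (K (tword n t) t).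

(** Any point of a deep enough cell lies within [r i] and [r j] of the two centers. *)
Let center_cauchy i j t : I01 t -> mdist (center i t) (center j t) < r i + r j.
Proof.
move=> It.
have [y cy] := cell_tword_nonempty (maxn i j).+1 It.
have hi : mdist (center i t) y < r i.
  by apply: A_ball; apply: cell_A cy _; rewrite ltnS leq_maxl.
have hj : mdist (center j t) y < r j.
  by apply: A_ball; apply: cell_A cy _; rewrite ltnS leq_maxr.
apply: le_lt_trans (mdist_tri _ y _) _.
by rewrite (mdist_sym y); apply: ltrD.
Qed.

(** Membership in [I01] sits inside the existential so that a limit can be chosen for every real;
    elsewhere any point serves. *)
Let limit_exists t : exists l, I01 t ->
  forall e : R, 0 < e -> exists N, forall n, (N <= n)%N -> mdist (center n t) l < e.
Proof.
have [It|nIt] := pselect (I01 t); last first.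
  by have [x _] := mcar_inhabited X; exists x.
have [e e0|l hl] := @mcomplete R X (center^~ t); last by exists l.
have [|N HN] := r_small (e := e / 2); first lra.
exists N => i j Ni Nj; apply: lt_trans (center_cauchy i j It) _.
by have := HN _ Ni; have := HN _ Nj; lra.
Qed.

Let phi t : mcar X := projT1 (cid (limit_exists t)).

Let center_phi n t : I01 t -> mdist (center n t) (phi t) <= r n.
Proof.
move=> It; apply/ler_addgt0Pr => e e0.
have [|N1 H1] := projT2 (cid (limit_exists t)) It (e / 2); first lra.
have [|N2 H2] := r_small (e := e / 2); first lra.
have h1 := H1 _ (leq_maxl N1 N2); have h2 := H2 _ (leq_maxr N1 N2).
apply: le_trans (mdist_tri _ (center (maxn N1 N2) t) _) _.
by have := center_cauchy n (maxn N1 N2) It; rewrite -/(phi t) in h1; lra.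
Qed.

(* The radius [3 r n] makes these sets of words increase along the refinement. *)
Let good (U : set (mcar X)) n : set (seq nat) :=
  [set w | mball (@mdist R X) (D (head 0%N w)) (3 * r n) `<=` U].

(** Going through [x], distances add up to [r n + r n / 2 + 3 * r n / 2 = 3 * r n]; 3 is the least
    factor for which this closes. *)
Let goodS U n w k x : mdist (D (head 0%N w)) x <= r n -> mdist (D k) x <= r n.+1 ->
  good U n w -> good U n.+1 (k :: w).
Proof.
move=> h1 h2 gw y /= ky; apply: gw; rewrite /mball/=.
have t1 := mdist_tri (D (head 0%N w)) x y.
have t2 := mdist_tri x (D k) y.
by move: ky h2 t2; rewrite /mball/= rS (mdist_sym x (D k)) => *; lra.
Qed.

Let goodP U x (c : nat -> nat) : mopen (@mdist R X) U ->
  (forall n, mdist (D (c n)) x <= r n) ->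
  (U x <-> exists n, mball (@mdist R X) (D (c n)) (3 * r n) `<=` U).
Proof.
move=> oU hc; split=> [Ux|[n h]].
  have [e e0 eU] := oU _ Ux.
  (* Points of the ball are within [r N + 3 * r N] of [x]. *)
  have [|N HN] := r_small (e := e / 4); first lra.
  exists N => y; rewrite /mball/= => hy; apply: eU; rewrite /mball/=.
  apply: le_lt_trans (mdist_tri _ (D (c N)) _) _.
  by have := HN N (leqnn N); have := hc N; rewrite (mdist_sym x); lra.
by apply: h; rewrite /mball/=; have := hc n; have := r_gt0 n; lra.
Qed.

(** Both [U] and its preimage are increasing unions of the sets of points, resp. times, whose word
    is good. These agree in measure at each level, and continuity from below passes to the limit. *)
Let phi_open (U : set (borel X)) : mopen (@mdist R X) U ->
  measurable (@I01 R `&` phi @^-1` U) /\ leb (@I01 R `&` phi @^-1` U) = mu U.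
Proof.
move=> oU.
pose T n := @I01 R `&` [set t | good U n (tword n.+1 t)].
pose Y n : set (borel X) := [set x | good U n (xword n.+1 x)].
have TE : @I01 R `&` phi @^-1` U = \bigcup_n T n.
  apply/seteqP; split => [t [It /= Ut]|t [n _ [It g]]].
    have [n gn] := (goodP oU (fun n => center_phi n It)).1 Ut.
    by exists n.
  by split => //=; apply/(goodP oU (fun n => center_phi n It)); exists n.
have xball x n : mdist (D (xK n x)) x <= r n by apply/ltW/A_ball/AxK.
have YE : U = \bigcup_n Y n.
  apply/seteqP; split => [x Ux|x [n _ g]].
    by have [n gn] := (goodP oU (xball x)).1 Ux; exists n.
  by apply/(goodP oU (xball x)); exists n.
have mT n : measurable (T n) by have [] := word_measure n.+1 (good U n).
have mY n : measurable (Y n) by have [] := word_measure n.+1 (good U n).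
have TY n : leb (T n) = mu (Y n) by have [] := word_measure n.+1 (good U n).
have mUT : measurable (\bigcup_n T n) by exact: bigcup_measurable.
have mUY : measurable (\bigcup_n Y n) by exact: bigcup_measurable.
rewrite TE; split => //.
have hT : {homo T : n m / (n <= m)%N >-> (n <= m)%O}.
  apply/nondecreasing_seqP => n; apply/subsetPset => t [It gt]; split => //.
  exact: (@goodS U n (tword n.+1 t) (K (tword n.+1 t) t) (phi t)
    (center_phi n It) (center_phi n.+1 It) gt).
have hY : {homo Y : n m / (n <= m)%N >-> (n <= m)%O}.
  apply/nondecreasing_seqP => n; apply/subsetPset => x gx.
  exact: (@goodS U n (xword n.+1 x) (xK n.+1 x) x (xball x n) (xball x n.+1) gx).
have c1 := @nondecreasing_cvg_mu _ _ _ (@lebesgue_measure R) T mT mUT hT.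
have c2 := @nondecreasing_cvg_mu _ _ _ (@mu R X) Y mY mUY hY.
have c3 : (@lebesgue_measure R \o T) n @[n --> \oo] --> mu (\bigcup_n Y n).
  move: c2; apply: cvg_trans; apply: near_eq_cvg; apply: nearW => n /=.
  by rewrite -TY.
rewrite [in RHS]YE; exact: (cvg_unique (@ereal_hausdorff R) c1 c3).
Qed.

Lemma param_exists : exists phi : R -> mcar X, param phi.
Proof.
exists phi => B bB.
suff [h1 h2] : measurable (@I01 R `&` phi @^-1` B) /\
    leb (@I01 R `&` phi @^-1` B) = mu (B : set (borel X)).
  by split => //; rewrite h2 muE.
(* Open sets form a pi-system generating the Borel sets, so agreement of the two finite measures
   extends; measurability of the preimage is carried along. *)
move: B bB; apply: (@dynkin_induction _ (borel X) (mopen (@mdist R X))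
  (fun B => measurable (@I01 R `&` phi @^-1` B) /\
    leb (@I01 R `&` phi @^-1` B) = mu B)) => //.
- move=> U V oU oV x [Ux Vx].
  have [e e0 eU] := oU _ Ux; have [f f0 fV] := oV _ Vx.
  exists (Num.min e f); first by rewrite lt_min e0.
  by move=> y; rewrite /mball/= lt_min => /andP[xe xf]; split; [exact: eU|exact: fV].
- rewrite preimage_setT setIT mu_setT; split; [exact: measurable_I01|exact: leb_I01].
- move=> S mS [h1 h2].
  have -> : @I01 R `&` phi @^-1` (~` S) = @I01 R `\` (@I01 R `&` phi @^-1` S).
    by rewrite setDIr setDv set0U.
  have mI := @measurable_I01 R.
  split; first exact: measurableD.
  rewrite /leb measureD//; last by rewrite [X in (X < _)%E]leb_I01 ltry.
  rewrite setIA setIid -setTD measureD//; last by rewrite [X in (X < _)%E]mu_setT ltry.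
  by rewrite setTI [X in (X - _)%E]leb_I01 [X in (_ = X - _)%E]mu_setT; congr (_ - _)%E.
- move=> F mF tF PF; rewrite preimage_bigcup setI_bigcupr.
  split; first by apply: bigcup_measurable => k _; have [] := PF k.
  have tF' : trivIset setT (fun k => @I01 R `&` phi @^-1` F k).
    by move=> i j _ _ [t [[_ ti] [_ tj]]]; apply: tF => //; exists (phi t).
  have mk k : measurable (@I01 R `&` phi @^-1` F k) by have [] := PF k.
  have mk' : measurable (\bigcup_k (@I01 R `&` phi @^-1` F k)).
    by apply: bigcup_measurable => k _.
  apply: etrans (@measure_semi_bigcup _ _ _ (@lebesgue_measure R) _ mk tF' mk') _.
  rewrite measure_semi_bigcup//; last exact: bigcup_measurable.
  by apply: eq_eseriesr => k _; have [] := PF k.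
Qed.

End ParamExistence.

(** * The box and observable distances *)

Section Deltas.
Context {R : realType}.
Implicit Types X Y Z : mmspace R.

Local Notation I := (@I01 R).

(** * The Ky Fan metric *)

Definition dev (f g : R -> R) (e : R) : set R := I `&` [set t | e < `|f t - g t|].

Lemma leb_subI (A : set R) (e : R) : A `<=` I -> 1 <= e -> (leb A <= e%:E)%E.
Proof. by move=> /leb_mono AI e1; apply: le_trans AI _; rewrite leb_I01 lee_fin. Qed.

Lemma dev_mono f g (e e' : R) : e <= e' -> (leb (dev f g e) <= e%:E)%E ->
  (leb (dev f g e') <= e'%:E)%E.
Proof.
move=> ee' h; apply: le_trans (_ : (e%:E <= _)%E); last by rewrite lee_fin.
apply: le_trans h; apply: leb_mono => t [It /= ht]; split => //=; exact: le_lt_trans ht.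
Qed.

Lemma kyfan_lbound f g : has_lbound
  [set e : R | 0 <= e /\ (leb (dev f g e) <= e%:E)%E].
Proof. by exists 0 => e []. Qed.

Lemma kyfan_nonempty f g :
  [set e : R | 0 <= e /\ (leb (dev f g e) <= e%:E)%E] !=set0.
Proof. by exists 1; split => //; apply: leb_subI => // t []. Qed.

Lemma kyfan_ge0 (f g : R -> R) : 0 <= kyfan f g.
Proof. by apply: lb_le_inf (kyfan_nonempty f g) _ => e []. Qed.

Lemma kyfan_le f g (e : R) : 0 <= e -> (leb (dev f g e) <= e%:E)%E -> kyfan f g <= e.
Proof. by move=> e0 h; apply: ge_inf (kyfan_lbound f g) _ _. Qed.

Lemma kyfan_le1 (f g : R -> R) : kyfan f g <= 1.
Proof. by apply: kyfan_le => //; apply: leb_subI => // t []. Qed.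

Lemma kyfan_lt f g (e : R) : kyfan f g < e -> (leb (dev f g e) <= e%:E)%E.
Proof. by move=> /(inf_lt (kyfan_nonempty f g))[e' [_ h] /ltW e'e]; apply: dev_mono h. Qed.

(** The bounds on [k] make the sets of values bounded, so that the real [inf] and [sup] have their
    usual meaning. [k] is abstract because it serves with either order of arguments. *)
Lemma sup_inf_lt (T U : Type) (A : set T) (B : set U) (k : T -> U -> R) (e : R) :
  (forall f g, 0 <= k f g <= 1) -> B !=set0 ->
  sup [set inf [set k f g | g in B] | f in A] < e ->
  forall f, A f -> exists2 g, B g & k f g < e.
Proof.
move=> k01 [g0 Bg0] hs f Af.
have lbk f' : has_lbound [set k f' g | g in B].
  by exists 0 => _ [g _ <-]; have /andP[] := k01 f' g.
have : inf [set k f g | g in B] < e.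
  apply: le_lt_trans hs; apply: ub_le_sup; last by exists f.
  exists 1 => _ [f' _ <-]; have /andP[_] := k01 f' g0.
  by apply: le_trans; apply: ge_inf => //; exists g0.
have ne : [set k f g | g in B] !=set0 by exists (k f g0), g0.
by move=> /(inf_lt ne)[_ [g Bg <-] h]; exists g.
Qed.

Lemma sup_inf_le (T U : Type) (A : set T) (B : set U) (k : T -> U -> R) (e : R) :
  (forall f g, 0 <= k f g) -> A !=set0 ->
  (forall f, A f -> exists2 g, B g & k f g <= e) ->
  sup [set inf [set k f g | g in B] | f in A] <= e.
Proof.
move=> k0 [f0 Af0] h; apply: ge_sup; first by exists (inf [set k f0 g | g in B]), f0.
move=> _ [f Af <-]; have [g Bg hg] := h f Af.
by apply: le_trans hg; apply: ge_inf; [exists 0 => _ [? _ <-]|exists g].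
Qed.

(** * Closeness of observables and of distance functions *)

Definition nonexpansive X (u : mcar X -> R) : Prop :=
  forall x y, `|u x - u y| <= mdist x y.

(** One direction of the Hausdorff condition for observables, freed of infima. *)
Definition obs_close X Y (phi : R -> mcar X) (psi : R -> mcar Y) (e : R) : Prop :=
  forall u, nonexpansive u -> exists2 v, nonexpansive v &
    (leb (dev (u \o phi) (v \o psi) e) <= e%:E)%E.

Definition box_close X Y (phi : R -> mcar X) (psi : R -> mcar Y) (e : R) : Prop :=
  exists I0 : set R, [/\ measurable I0 /\ I0 `<=` I, ((1 - e)%:E <= leb I0)%E &
    forall s t, I0 s -> I0 t ->
      `| mdist (phi s) (phi t) - mdist (psi s) (psi t) | <= e].

Lemma box_close_sym X Y (phi : R -> mcar X) (psi : R -> mcar Y) (e : R) :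
  box_close phi psi e -> box_close psi phi e.
Proof.
by move=> [I0 [h1 h2 h3]]; exists I0; split => // s t Is It; rewrite distrC; exact: h3.
Qed.

Lemma nonexpansive_cst X (c : R) : nonexpansive (fun _ : mcar X => c).
Proof. by move=> x y; rewrite subrr normr0 mdist_ge0. Qed.

Lemma leb_compl (A : set R) (e : R) : measurable A -> A `<=` I ->
  ((1 - e)%:E <= leb A)%E -> (leb (I `\` A) <= e%:E)%E.
Proof.
move=> mA AI h.
have -> : leb (I `\` A) = (leb I - leb A)%E.
  have := @measureD _ _ _ (@lebesgue_measure R) I A (@measurable_I01 R) mA.
  rewrite (setIidr AI); apply.
  by rewrite [X in (X < _)%E]leb_I01 ltry.
have : (leb A <= 1)%E by rewrite -leb_I01; exact: leb_mono.
rewrite leb_I01; case: (leb A) h => [a| |]//.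
by rewrite -EFinB !lee_fin => h1 h2; lra.
Qed.

(** McShane extension: [u] is carried along [phi] and [psi] on [I0] and extended to Y by the infimum
    of [u (phi s) + mdist (psi s) y]. The distortion on [I0] lowers the value at [psi t] by at most
    [e]. *)
Lemma box_obs_close X Y (phi : R -> mcar X) (psi : R -> mcar Y) (e : R) :
  box_close phi psi e -> obs_close phi psi e.
Proof.
move=> [I0 [[mI0 I0I] lI0 h]] u u1.
have hI : (leb (I `\` I0) <= e%:E)%E by exact: leb_compl.
have [[t0 It0]|I0e] := pselect (I0 !=set0); last first.
  (* If [I0] is empty then all of [I] has measure at most [e], and any function matches. *)
  exists (fun=> 0); first exact: nonexpansive_cst.
  apply: le_trans hI; apply: leb_mono => t [It _]; split => // I0t.
  by apply: I0e; exists t.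
pose S y := [set u (phi s) + mdist (psi s) y | s in I0].
have S0 y : S y !=set0 by exists (u (phi t0) + mdist (psi t0) y), t0.
have lbS t y : I0 t -> lbound (S y) (u (phi t) - e - mdist (psi t) y).
  move=> It _ [s Is <-]; have := u1 (phi t) (phi s).
  have := h t s It Is; rewrite !ler_norml => /andP[h1 h2] /andP[h3 h4].
  by have := mdist_tri (psi t) y (psi s); rewrite (mdist_sym y); lra.
have hlb y : has_lbound (S y) by exists (u (phi t0) - e - mdist (psi t0) y); exact: lbS.
have half y y' : inf (S y) <= inf (S y') + mdist y y'.
  rewrite -lerBlDr; apply: lb_le_inf => // _ [s Is <-].
  rewrite lerBlDr; apply: (@le_trans _ _ (u (phi s) + mdist (psi s) y)).
    by apply: ge_inf => //; exists s.
  by rewrite -addrA lerD2l (mdist_sym y) mdist_tri.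
exists (fun y => inf (S y)).
  move=> y y'; rewrite ler_norml; have := half y y'; have := half y' y.
  by rewrite (mdist_sym y'); lra.
apply: le_trans hI; apply: leb_mono => t [It /= ht]; split => // I0t.
move: ht; apply/negP; rewrite -leNgt ler_norml; apply/andP; split.
  have : inf (S (psi t)) <= u (phi t).
    by apply: ge_inf => //; exists t => //; rewrite mdist_refl addr0.
  have e0 : 0 <= e.
    by apply: le_trans (h t t I0t I0t).
  by lra.
have : u (phi t) - e <= inf (S (psi t)).
  by apply: lb_le_inf => //; have := lbS t (psi t) I0t; rewrite mdist_refl subr0.
by lra.
Qed.

Lemma lip1P X (phi : R -> mcar X) f :
  lip1 phi f <-> exists2 u, nonexpansive u & f = u \o phi.
Proof. by split=> [[u [? ?]]|[u ? ?]]; exists u. Qed.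

Lemma lip1_nonempty X (phi : R -> mcar X) : lip1 phi !=set0.
Proof. by exists (cst 0); apply/lip1P; exists (fun=> 0) => //; exact: nonexpansive_cst. Qed.

Lemma dev_sym f g (e : R) : dev f g e = dev g f e.
Proof. by rewrite /dev; congr setI; apply/seteqP; split=> t /=; rewrite distrC. Qed.

Lemma hausdorff_lt X Y (phi : R -> mcar X) (psi : R -> mcar Y) (e : R) :
  hausdorff_kf (lip1 phi) (lip1 psi) < e -> obs_close phi psi e /\ obs_close psi phi e.
Proof.
have k01 f g : 0 <= @kyfan R f g <= 1 by rewrite kyfan_ge0 kyfan_le1.
rewrite /hausdorff_kf gt_max => /andP[h1 h2]; split => u u1.
  have [|_ /lip1P[v v1 ->] /kyfan_lt h] :=
    sup_inf_lt k01 (lip1_nonempty psi) h1 (f := u \o phi); first by apply/lip1P; exists u.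
  by exists v.
have [|_ /lip1P[v v1 ->] /kyfan_lt h] :=
  sup_inf_lt (k := fun f g => kyfan g f) (fun f g => k01 g f) (lip1_nonempty phi) h2
  (f := u \o psi); first by apply/lip1P; exists u.
by exists v => //; rewrite dev_sym.
Qed.

Lemma hausdorff_le X Y (phi : R -> mcar X) (psi : R -> mcar Y) (e : R) : 0 <= e ->
  obs_close phi psi e -> obs_close psi phi e ->
  hausdorff_kf (lip1 phi) (lip1 psi) <= e.
Proof.
move=> e0 h1 h2; rewrite /hausdorff_kf ge_max; apply/andP; split.
  apply: sup_inf_le (lip1_nonempty phi) _ => [f g|f /lip1P[u u1 ->]]; first exact: kyfan_ge0.
  by have [v v1 hv] := h1 u u1; exists (v \o psi); [apply/lip1P; exists v|exact: kyfan_le].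
apply: (@sup_inf_le _ _ _ _ (fun f g => kyfan g f)) (lip1_nonempty psi) _
  => [f g|f /lip1P[u u1 ->]]; first exact: kyfan_ge0.
have [v v1 hv] := h2 u u1; exists (v \o phi); first by apply/lip1P; exists v.
by apply: kyfan_le => //; rewrite dev_sym.
Qed.

(** * The two distances in terms of closeness *)

Lemma box_set_nonempty X Y : [set e : R | 0 <= e /\
    exists (phi : R -> mcar X) (psi : R -> mcar Y) (I0 : set R),
      [/\ param phi, param psi, measurable I0 /\ I0 `<=` I,
          ((1 - e)%:E <= leb I0)%E &
          forall s t, I0 s -> I0 t ->
            `| mdist (phi s) (phi t) - mdist (psi s) (psi t) | <= e]] !=set0.
Proof.
have [phi pphi] := param_exists X; have [psi ppsi] := param_exists Y.
exists 1; split => //; exists phi, psi, set0.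
by split => //; [split => // t [] | rewrite subrr leb_ge0].
Qed.

Lemma boxdist_ge0 X Y : 0 <= boxdist X Y.
Proof. by apply: lb_le_inf (box_set_nonempty X Y) _ => e []. Qed.

Lemma boxdist_lt X Y (e : R) : boxdist X Y < e ->
  exists phi psi, [/\ @param R X phi, @param R Y psi & box_close phi psi e].
Proof.
move=> /(inf_lt (box_set_nonempty X Y))[e' [e'0 [phi [psi [I0 [p1 p2 h1 h2 h3]]]]] /ltW e'e].
exists phi, psi; split => //; exists I0; split => //.
  by apply: le_trans h2; rewrite lee_fin; lra.
by move=> s t Is It; apply: le_trans e'e; exact: h3.
Qed.

Lemma boxdist_le X Y (phi : R -> mcar X) (psi : R -> mcar Y) (e : R) : 0 <= e ->
  param phi -> param psi -> box_close phi psi e -> boxdist X Y <= e.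
Proof.
move=> e0 p1 p2 [I0 [h1 h2 h3]]; apply: ge_inf; first by exists 0 => x [].
by split => //; exists phi, psi, I0.
Qed.

(** A negative value lies below its own half, so observables would be matched at a negative level,
    which bounds a measure by a negative number. *)
Lemma hausdorff_ge0 X Y (phi : R -> mcar X) (psi : R -> mcar Y) :
  0 <= hausdorff_kf (lip1 phi) (lip1 psi).
Proof.
rewrite leNgt; apply/negP => h.
have [/(_ _ (nonexpansive_cst 0))[v _ hv] _] := hausdorff_lt (lt_le_trans h (lexx _)).
have : hausdorff_kf (lip1 phi) (lip1 psi) < hausdorff_kf (lip1 phi) (lip1 psi) / 2 by lra.
move=> /hausdorff_lt[/(_ _ (nonexpansive_cst 0))[w _ hw] _].
have := le_trans (leb_ge0 _) hw; rewrite lee_fin; lra.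
Qed.

Lemma conc_set_nonempty X Y :
  [set e : R | exists (phi : R -> mcar X) (psi : R -> mcar Y),
     [/\ param phi, param psi & e = hausdorff_kf (lip1 phi) (lip1 psi)]] !=set0.
Proof.
have [phi pphi] := param_exists X; have [psi ppsi] := param_exists Y.
by exists (hausdorff_kf (lip1 phi) (lip1 psi)), phi, psi.
Qed.

Lemma concdist_ge0 X Y : 0 <= concdist X Y.
Proof.
apply: lb_le_inf (conc_set_nonempty X Y) _ => e [phi [psi [_ _ ->]]].
exact: hausdorff_ge0.
Qed.

Lemma concdist_lt X Y (e : R) : concdist X Y < e ->
  exists phi psi, [/\ @param R X phi, @param R Y psi, obs_close phi psi e & obs_close psi phi e].
Proof.
move=> /(inf_lt (conc_set_nonempty X Y))[e' [phi [psi [p1 p2 ->]]] /hausdorff_lt[h1 h2]].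
by exists phi, psi.
Qed.

Lemma concdist_le X Y (phi : R -> mcar X) (psi : R -> mcar Y) (e : R) : 0 <= e ->
  param phi -> param psi -> obs_close phi psi e -> obs_close psi phi e ->
  concdist X Y <= e.
Proof.
move=> e0 p1 p2 h1 h2; apply: le_trans (hausdorff_le e0 h1 h2).
apply: ge_inf; last by exists phi, psi.
by exists 0 => x [phi' [psi' [_ _ ->]]]; exact: hausdorff_ge0.
Qed.

End Deltas.

(** * Isomorphism classes and scaling *)

Section Scaling.
Context {R : realType}.
Implicit Types (X Y Z : mmspace R) (s t : R).

Lemma lip_borel X Y (k : R) (f : mcar X -> mcar Y) (B : set (mcar Y)) : 0 <= k ->
  (forall x y, mdist (f x) (f y) <= k * mdist x y) ->
  mborel (@mdist R Y) B -> mborel (@mdist R X) (f @^-1` B).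
Proof.
move=> k0 fk mB.
suff mf : measurable_fun setT (f : borel X -> borel Y).
  by have := mf measurableT B mB; rewrite setTI.
apply: (@measurability _ _ (borel X) (borel Y) setT f (mopen (@mdist R Y))) => // _ [U oU <-].
rewrite setTI; apply: mopen_borel => x Ux; have [e e0 eU] := oU _ Ux.
(* The denominator [k + 1] stays positive when [k = 0]. *)
exists (e / (k + 1)); first by rewrite divr_gt0//; lra.
move=> y; rewrite /mball/= ltr_pdivlMr; last lra.
move=> xy; apply: eU; rewrite /mball/=; apply: le_lt_trans (fk x y) _.
by have := mdist_ge0 x y; nra.
Qed.

Lemma mm_isoE X Y : mm_iso X Y = mm_iso_scaled 1 X Y.
Proof.
by apply/propext; split => -[f [f1 [f2 f3]]]; exists f; split => //; split => // x x';
  rewrite f2 mul1r.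
Qed.

Lemma mm_iso_scaled_refl X : mm_iso_scaled 1 X X.
Proof. by exists id; split=> [y|]; [exists y|split=> // x x'; rewrite mul1r]. Qed.

Lemma mm_iso_scaled_trans s t X Y Z : 0 <= t ->
  mm_iso_scaled s X Y -> mm_iso_scaled t Y Z -> mm_iso_scaled (t * s) X Z.
Proof.
move=> t0 [f [f1 [f2 f3]]] [g [g1 [g2 g3]]]; exists (g \o f); split.
  by move=> z; have [y <-] := g1 z; have [x <-] := f1 y; exists x.
split=> [x x'|B mB] /=; first by rewrite g2 f2 mulrA.
rewrite g3// f3//; apply: (lip_borel t0) mB => x y; by rewrite g2.
Qed.

Lemma mm_iso_scaled_sym t X Y : 0 < t -> mm_iso_scaled t X Y -> mm_iso_scaled t^-1 Y X.
Proof.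
move=> t0 [f [f1 [f2 f3]]].
have [g fg] := choice f1.
have gf x : g (f x) = x.
  apply/mdist_sep/eqP; have := f2 (g (f x)) x; rewrite fg mdist_refl => /esym/eqP.
  by rewrite mulf_eq0 gt_eqF.
have gt y y' : mdist (g y) (g y') = t^-1 * mdist y y'.
  by have := f2 (g y) (g y'); rewrite !fg => ->; rewrite mulKf// gt_eqF.
exists g; split; first by move=> x; exists (f x).
split => // B mB; have ti0 : 0 <= t^-1 by rewrite invr_ge0 ltW.
rewrite f3; last by apply: (lip_borel ti0) mB => x y; rewrite gt.
by rewrite -comp_preimage; congr mmeas; apply/seteqP; split => x /=; rewrite gf.
Qed.

Lemma mm_iso_refl X : mm_iso X X.
Proof. by rewrite mm_isoE; exact: mm_iso_scaled_refl. Qed.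

Lemma mm_iso_sym X Y : mm_iso X Y -> mm_iso Y X.
Proof. by rewrite !mm_isoE => /mm_iso_scaled_sym; rewrite invr1; exact. Qed.

Lemma mm_iso_trans X Y Z : mm_iso X Y -> mm_iso Y Z -> mm_iso X Z.
Proof.
by rewrite !mm_isoE => h1 h2; have := mm_iso_scaled_trans ler01 h1 h2; rewrite mulr1.
Qed.

Lemma cls_eq X Y : mm_iso X Y -> cls X = cls Y.
Proof.
move=> XY; apply/seteqP; split => Z /=; last exact: mm_iso_trans.
exact/mm_iso_trans/mm_iso_sym.
Qed.

Lemma clsP A X : @isClass R A -> A X -> A = cls X.
Proof. by move=> [Y ->] YX; exact: cls_eq. Qed.

Lemma mem_cls X : cls X X. Proof. exact: mm_iso_refl. Qed.

Lemma isClass_cls X : isClass (cls X). Proof. by exists X. Qed.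

Lemma scale_exists t X : 0 < t -> exists Y, mm_iso_scaled t X Y.
Proof.
move=> t0; pose d (x y : mcar X) := t * mdist x y.
(* Scaling keeps the open sets, hence the Borel sets, so the axioms on the measure carry over. *)
have oE : mopen d = mopen (@mdist R X).
  apply/seteqP; split => U oU x Ux; have [r r0 rU] := oU x Ux.
    exists (r / t); first exact: divr_gt0.
    by move=> y; rewrite /mball/= ltr_pdivlMr// mulrC; exact: rU.
  exists (t * r); first exact: mulr_gt0.
  by move=> y; rewrite /mball/= ltr_pM2l//; exact: rU.
have bE : mborel d = mborel (@mdist R X) by rewrite /mborel oE.
have d1 x : d x x = 0 by rewrite /d mdist_refl mulr0.
have d2 x y : d x y = 0 -> x = y.
  by move=> /eqP; rewrite mulf_eq0 gt_eqF//= => /eqP/mdist_sep.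
have d3 x y : d x y = d y x by rewrite /d mdist_sym.
have d4 x y z : d x z <= d x y + d y z by rewrite /d -mulrDr ler_pM2l// mdist_tri.
have d5 (u : nat -> mcar X) :
    (forall e : R, 0 < e -> exists N, forall m n, (N <= m)%N -> (N <= n)%N ->
        d (u m) (u n) < e) ->
    exists l, forall e : R, 0 < e -> exists N, forall n, (N <= n)%N ->
        d (u n) l < e.
  move=> cu; have [e e0|l hl] := @mcomplete R X u.
    have [N HN] := cu (t * e) (mulr_gt0 t0 e0).
    by exists N => m n Nm Nn; rewrite -(ltr_pM2l t0); exact: HN.
  exists l => e e0; have [N HN] := hl (e / t) (divr_gt0 e0 t0).
  by exists N => n /HN; rewrite ltr_pdivlMr// mulrC.
have d6 : exists D : nat -> mcar X, forall x (e : R), 0 < e -> exists n, d x (D n) < e.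
  have [D HD] := mseparable X; exists D => x e e0.
  have [n hn] := HD x (e / t) (divr_gt0 e0 t0).
  by exists n; move: hn; rewrite ltr_pdivlMr// mulrC.
have m1 (A : set (mcar X)) : mborel d A -> 0 <= mmeas A by rewrite bE; exact: mmeas_ge0.
have m2 (F : nat -> set (mcar X)) :
    (forall n, mborel d (F n)) ->
    (forall m n, m <> n -> F m `&` F n = set0) ->
    forall e : R, 0 < e -> exists N, forall n, (N <= n)%N ->
      `| \sum_(0 <= k < n) mmeas (F k) - mmeas (\bigcup_k F k) | < e.
  by rewrite bE; exact: mmeas_sigma_additive.
have m3 x (r : R) : 0 < r -> 0 < mmeas (mball d x r).
  move=> r0; have := @msupp R X x (r / t) (divr_gt0 r0 t0).
  congr (0 < mmeas _); apply/seteqP; split => y; rewrite /mball/= ltr_pdivlMr// mulrC//.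
exists (MMSpace d1 d2 d3 d4 d5 d6 m1 (mmeas0 X) (mmeasT X) m2 m3).
by exists id; split=> [y|]; [exists y|].
Qed.

Lemma actC_cls t X Y : 0 < t -> mm_iso_scaled t X Y -> actC t (cls X) = cls Y.
Proof.
move=> t0 tXY; apply/seteqP; split => [Z [X']|Z].
  rewrite /cls/= !mm_isoE => XX' tX'Z.
  have h := mm_iso_scaled_trans (ltW t0) XX' tX'Z; rewrite mulr1 in h.
  have h' := mm_iso_scaled_sym t0 tXY.
  have := mm_iso_scaled_trans (ltW t0) h' h; by rewrite divff// gt_eqF.
rewrite /cls/= mm_isoE => YZ; exists X; first exact: mm_iso_refl.
by have := mm_iso_scaled_trans ler01 tXY YZ; rewrite mul1r.
Qed.

Lemma isClass_act t A : 0 < t -> @isClass R A -> isClass (actC t A).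
Proof.
move=> t0 [X ->]; have [Y tXY] := scale_exists X t0.
by rewrite (actC_cls t0 tXY); exists Y.
Qed.

Lemma actC1 A : @isClass R A -> actC 1 A = A.
Proof. by move=> [X ->]; exact: (actC_cls ltr01 (mm_iso_scaled_refl X)). Qed.

Lemma actCM s t A : 0 < s -> 0 < t -> @isClass R A -> actC s (actC t A) = actC (s * t) A.
Proof.
move=> s0 t0 [X ->]; have [Y tXY] := scale_exists X t0.
have [Z sYZ] := scale_exists Y s0; rewrite (actC_cls t0 tXY) (actC_cls s0 sYZ).
by rewrite (actC_cls (mulr_gt0 s0 t0) (mm_iso_scaled_trans (ltW s0) tXY sYZ)).
Qed.

Lemma is_point_scaled t X Y : mm_iso_scaled t X Y -> is_point X -> is_point Y.
Proof.
by move=> [f [f1 _]] pX y y'; have [x <-] := f1 y; have [x' <-] := f1 y'; rewrite (pX x x').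
Qed.

Lemma Estar_act t A : 0 < t -> Estar A -> Estar (actC t A).
Proof.
move=> t0 [cA nA]; split; first exact: isClass_act.
move=> [Y [[X AX tXY] pY]]; apply: nA; exists X; split => //.
exact: is_point_scaled (mm_iso_scaled_sym t0 tXY) pY.
Qed.

Lemma piS_act t A : 0 < t -> @isClass R A -> piS (actC t A) = piS A.
Proof.
move=> t0 cA; apply/seteqP; split => _ [s s0 ->].
  by exists (s * t); [exact: mulr_gt0|rewrite actCM].
exists (s / t); first exact: divr_gt0.
by rewrite actCM ?divr_gt0// divfK// gt_eqF.
Qed.

Lemma piS_eq A B : @isClass R B -> piS A = piS B -> exists2 t, 0 < t & B = actC t A.
Proof. by move=> cB e; have : piS A B by rewrite e; exists 1; rewrite ?actC1. Qed.

Lemma param_scaled t X Y (f : mcar X -> mcar Y) (phi : R -> mcar X) : 0 <= t ->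
  (forall x x', mdist (f x) (f x') = t * mdist x x') ->
  (forall B, mborel (@mdist R Y) B -> mmeas B = mmeas (f @^-1` B)) ->
  param phi -> param (f \o phi).
Proof.
move=> t0 f2 f3 pphi B mB; rewrite f3// comp_preimage; apply: pphi.
by apply: (lip_borel t0) mB => x y; rewrite f2.
Qed.

End Scaling.

(** * The size of a space *)

Section Size.
Context {R : realType}.
Implicit Types (X Y : mmspace R) (a k r t e : R).

Lemma mmeas_le X (A B : set (mcar X)) : mborel (@mdist R X) A -> mborel (@mdist R X) B ->
  A `<=` B -> mmeas A <= mmeas B.
Proof.
move=> mA mB AB; rewrite -lee_fin -!muE//.
by apply: (@le_measure _ _ _ (@mu R X)); rewrite ?inE.
Qed.

Lemma mmeas_le1 X (A : set (mcar X)) : mborel (@mdist R X) A -> mmeas A <= 1.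
Proof. by move=> mA; rewrite -lee_fin -muE// mu_le1. Qed.

Definition dev_set X (u : mcar X -> R) r c : set (mcar X) := [set x | r < `|u x - c|].

Lemma dev_set_borel X (u : mcar X -> R) r c : nonexpansive u ->
  mborel (@mdist R X) (dev_set u r c).
Proof.
move=> u1; apply: mopen_borel => x; rewrite /dev_set/= => h.
exists (`|u x - c| - r); first by rewrite subr_gt0.
move=> y; rewrite /mball/= => xy.
have := u1 x y; have := ler_distD (u y) (u x) c; lra.
Qed.

(** The pairs (k, r) that enter the size; the record [admissible] below is something else, a
    condition on distances. *)
Definition spread X k r : Prop :=
  exists2 u, nonexpansive u & forall c, k < mmeas (@dev_set X u r c).

Lemma spread_scaled t X Y k r : 0 < t -> mm_iso_scaled t X Y ->
  spread X k r -> spread Y k (t * r).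
Proof.
move=> t0 /(mm_iso_scaled_sym t0)[g [g1 [g2 g3]]] [u u1 hu].
exists (fun y => t * u (g y)).
  move=> y y'; rewrite -mulrBr normrM gtr0_norm//.
  have := u1 (g y) (g y'); rewrite g2 -(ler_pM2l t0) mulrA divff ?gt_eqF// mul1r.
  exact.
move=> c; have := hu (c / t).
rewrite g3; last exact: dev_set_borel.
have E y : `|t * u (g y) - c| = t * `|u (g y) - c / t|.
  by rewrite -{2}(gtr0_norm t0) -normrM mulrBr mulrCA divff ?gt_eqF// mulr1.
by congr (_ < mmeas _); apply/seteqP; split => y; rewrite /dev_set/= E ltr_pM2l.
Qed.

Lemma spread_iso X Y k r : mm_iso X Y -> spread X k r -> spread Y k r.
Proof. by rewrite mm_isoE => /(spread_scaled ltr01) h /h; rewrite mul1r. Qed.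

Lemma measurable_ballC X x r : mborel (@mdist R X) (~` mball (@mdist R X) x r).
Proof. by apply: (@measurableC _ (borel X)); exact: measurable_ball. Qed.

(** Complements of balls of integer radius decrease to the empty set. *)
Lemma ball_mass X (x0 : mcar X) e : 0 < e ->
  exists2 M, 0 <= M & mmeas (~` mball (@mdist R X) x0 M) <= e.
Proof.
move=> e0; pose F n : set (borel X) := ~` mball (@mdist R X) x0 n%:R.
have mF n : measurable (F n) by exact: measurable_ballC.
have F0 : \bigcap_n F n = set0.
  apply/seteqP; split => // x /(_ (Num.truncn (mdist x0 x)).+1 I); apply.
  by rewrite /mball/=; apply: truncnS_gt.
have hF : {homo F : n m / (n <= m)%N >-> (m <= n)%O}.
  move=> n m nm; apply/subsetPset => x xm xn; apply: xm.
  by apply: lt_le_trans xn _; rewrite ler_nat.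
have m0 : measurable (\bigcap_n F n) by rewrite F0.
have F1 : (@mu R X (F 0%N) < +oo)%E by rewrite ltey_eq fin_mu.
have := @nonincreasing_cvg_mu _ _ _ (@mu R X) F F1 mF m0 hF.
rewrite F0 measure0 => /fine_cvgP[_] /cvgrPdist_lt/(_ e e0)[N _ /(_ N (leqnn N))] /=.
rewrite sub0r normrN muE//= => h; exists N%:R => //.
by apply: le_trans (ltW h); exact: ler_norm.
Qed.

(** Tested against the constant [u x0], a 1-Lipschitz function deviates by more than [M] only
    outside the ball of radius [M], whose complement has mass at most [a]. *)
Lemma spread_bound X a : 0 < a ->
  exists2 M, 0 <= M & forall k r, a <= k -> spread X k r -> r <= M.
Proof.
move=> a0; have [x0 _] := mcar_inhabited X; have [M M0 hM] := ball_mass x0 a0.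
exists M => // k r ak [u u1 hu]; rewrite leNgt; apply/negP => Mr.
have : mmeas (dev_set u r (u x0)) <= mmeas (~` mball (@mdist R X) x0 M).
  apply: mmeas_le; [exact: dev_set_borel|exact: measurable_ballC|].
  move=> x; rewrite /dev_set /mball/= => rx xM; have := u1 x0 x.
  by rewrite distrC; lra.
by have := hu (u x0); lra.
Qed.

Lemma spread_lt1 X k r : spread X k r -> k < 1.
Proof.
move=> [u u1 hu]; apply: lt_le_trans (hu 0) _.
by apply: mmeas_le1; exact: dev_set_borel.
Qed.

Lemma spread_exists X : ~ is_point X -> exists k r, [/\ 0 < k, 0 < r & spread X k r].
Proof.
move=> nX; have [x [y xy]] : exists x y : mcar X, x <> y.
  apply: contrapT => h; apply: nX => x y; apply: contrapT => xy; apply: h.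
  by exists x, y.
have d0 : 0 < mdist x y.
  by rewrite lt_neqAle mdist_ge0 andbT eq_sym; apply/eqP => /mdist_sep.
set d := mdist x y in d0.
have d30 : 0 < d / 3 by lra.
have px := msupp x d30; have py := msupp y d30.
set mx := mmeas _ in px; set my := mmeas _ in py.
have u1 : nonexpansive (mdist x).
  move=> z z'; rewrite ler_norml; have := mdist_tri x z z'; have := mdist_tri x z' z.
  by rewrite (mdist_sym z'); lra.
(* The distance from [x] is below [d / 3] near [x] and above [2 * d / 3] near [y], so any constant
   misses one of the two balls by more than [d / 6]. Halving the mass gives the strict
   inequality. *)
exists (Num.min mx my / 2), (d / 6); split; [|lra|].
  by rewrite divr_gt0// lt_min px.
exists (mdist x) => // c.
have mmin : Num.min mx my / 2 < Num.min mx my.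
  by rewrite ltr_pdivrMr// mulr_natr mulr2n ltrDl lt_min px.
apply: lt_le_trans mmin _; rewrite ge_min.
have [hc|hc] := lerP (d / 2) c; apply/orP; [left|right].
  apply: mmeas_le; [exact: measurable_ball|exact: dev_set_borel|].
  move=> z; rewrite /mball /dev_set/= => xz.
  by rewrite ltr0_norm; lra.
apply: mmeas_le; [exact: measurable_ball|exact: dev_set_borel|].
move=> z; rewrite /mball /dev_set/= => yz.
have := mdist_tri x z y; rewrite (mdist_sym z) -/d => h.
by rewrite gtr0_norm; lra.
Qed.

Lemma spread_point X k r : is_point X -> 0 <= k -> 0 <= r -> ~ spread X k r.
Proof.
move=> pX k0 r0 [u u1 hu]; have [x0 _] := mcar_inhabited X.
have := hu (u x0); suff -> : dev_set u r (u x0) = set0 by rewrite mmeas0 ltNge k0.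
by apply/seteqP; split => // x; rewrite /dev_set/= (pX x x0) subrr normr0 ltNge r0.
Qed.

(** Outside a set of times of measure [e] the matching function [v] is within [e] of [u], so it
    still deviates from [c] by more than [r - e] there. *)
Lemma spread_close X Y (phi : R -> mcar X) (psi : R -> mcar Y) k r e :
  param phi -> param psi -> obs_close phi psi e ->
  spread X k r -> spread Y (k - e) (r - e).
Proof.
move=> p1 p2 oc [u u1 hu]; have [v v1 hv] := oc u u1.
exists v => // c; rewrite ltrBlDr; apply: lt_le_trans (hu c) _.
have [_ e1] := p1 _ (dev_set_borel r c u1).
have [_ e2] := p2 _ (dev_set_borel (r - e) c v1).
rewrite -lee_fin EFinD -e1 -e2; apply: le_trans (leeD (lexx _) hv).
apply: le_trans (lebU _ _); apply: leb_mono => t [It /=]; rewrite /dev_set/= => h.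
have [h'|h'] := ltP e `|u (phi t) - v (psi t)|; first by right.
left; split => //=.
by have := ler_distD (v (psi t)) (u (phi t)) c; lra.
Qed.

(** The value 0 is adjoined to keep the set nonempty, in particular for one-point spaces. *)
Definition size_set a X : set R :=
  [set z | z = 0 \/ exists k r, [/\ a <= k, 0 <= r, spread X k r & z = (k - a) * r]].

(* The weight [k - a] vanishes at [k = a], where the largest admissible [r] jumps;
   this makes [msize a] continuous. *)
Definition msize a X : R := sup (size_set a X).

Lemma size_set_ub a X M : 0 <= a -> 0 <= M ->
  (forall k r, a <= k -> spread X k r -> r <= M) -> ubound (size_set a X) M.
Proof.
move=> a0 M0 hM _ [->//|[k [r [ak r0 sp ->]]]].
by have := hM k r ak sp; have := spread_lt1 sp; nra.
Qed.

Lemma size_set_has_sup a X : 0 < a -> has_sup (size_set a X).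
Proof.
move=> a0; split; first by exists 0; left.
by have [M M0 hM] := spread_bound X a0; exists M; apply: size_set_ub => //; exact: ltW.
Qed.

Lemma le_msize a X k r : 0 < a -> a <= k -> 0 <= r -> spread X k r ->
  (k - a) * r <= msize a X.
Proof.
move=> a0 ak r0 sp; apply: ub_le_sup; first by case: (size_set_has_sup X a0).
by right; exists k, r.
Qed.

Lemma msize_ge0 a X : 0 < a -> 0 <= msize a X.
Proof. by move=> a0; apply: ub_le_sup; [case: (size_set_has_sup X a0)|left]. Qed.

Lemma msize_le a X M : 0 <= M ->
  (forall k r, a <= k -> 0 <= r -> spread X k r -> (k - a) * r <= M) -> msize a X <= M.
Proof.
move=> M0 h; apply: ge_sup; first by exists 0; left.
by move=> _ [->//|[k [r [ak r0 sp ->]]]]; exact: h.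
Qed.

Lemma msize_scaled_le a t X Y : 0 < a -> 0 < t -> mm_iso_scaled t X Y ->
  t * msize a X <= msize a Y.
Proof.
move=> a0 t0 tXY; rewrite -ler_pdivlMl//; apply: msize_le.
  by rewrite mulr_ge0 ?msize_ge0// invr_ge0 ltW.
move=> k r ak r0 /(spread_scaled t0 tXY) sp; rewrite ler_pdivlMl// mulrCA.
by apply: le_msize => //; rewrite mulr_ge0// ltW.
Qed.

Lemma msize_scaled a t X Y : 0 < a -> 0 < t -> mm_iso_scaled t X Y ->
  msize a Y = t * msize a X.
Proof.
move=> a0 t0 tXY; apply/eqP; rewrite eq_le msize_scaled_le// andbT.
have ti0 : 0 < t^-1 by rewrite invr_gt0.
by have := msize_scaled_le a0 ti0 (mm_iso_scaled_sym t0 tXY); rewrite ler_pdivrMl.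
Qed.

Lemma msize_gt0 a X k r : 0 < a -> a < k -> 0 < r -> spread X k r -> 0 < msize a X.
Proof.
move=> a0 ak r0 sp; apply: lt_le_trans (le_msize a0 (ltW ak) (ltW r0) sp).
by rewrite mulr_gt0// subr_gt0.
Qed.

Lemma msize_point a X : 0 < a -> is_point X -> msize a X = 0.
Proof.
move=> a0 pX; apply/eqP; rewrite eq_le msize_ge0// andbT; apply: msize_le => // k r ak r0.
by move/(spread_point pX); case => //; lra.
Qed.

Lemma msize_exists X : ~ is_point X -> exists2 a, 0 < a & 0 < msize a X.
Proof.
move=> /spread_exists[k [r [k0 r0 sp]]]; exists (k / 2); first lra.
by apply: msize_gt0 sp => //; lra.
Qed.

(** Lowering both [k] and [r] by [e] costs at most [e * ((k - a) + r)]. If the lowered pair is out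
    of range, the product is itself at most [e * (M + 1)]. *)
Lemma msize_close_le a X Y (phi : R -> mcar X) (psi : R -> mcar Y) e M :
  0 < a -> 0 <= e -> 0 <= M ->
  param phi -> param psi -> obs_close phi psi e ->
  (forall k r, a <= k -> spread X k r -> r <= M) ->
  msize a X <= msize a Y + e * (M + 1).
Proof.
move=> a0 e0 M0 p1 p2 oc hM.
have Y0 := msize_ge0 Y a0.
apply: msize_le; first by rewrite addr_ge0// mulr_ge0//; lra.
move=> k r ak r0 sp; have rM := hM k r ak sp; have k1 := spread_lt1 sp.
have sp' := spread_close p1 p2 oc sp.
have [hr|hr] := lerP e r; last by nra.
have [hk|hk] := lerP a (k - e); last by nra.
have re0 : 0 <= r - e by lra.
have := le_msize a0 hk re0 sp'; nra.
Qed.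

(** [M] bounds X alone, but at level [a / 2]: a pair of Y at level [a] moves to one of X at level
    [a - e >= a / 2], so [M + 1] bounds Y at level [a]. *)
Lemma msize_close a X Y (phi : R -> mcar X) (psi : R -> mcar Y) e M :
  0 < a -> 0 <= e -> e <= a / 2 -> e <= 1 -> 0 <= M ->
  param phi -> param psi -> obs_close phi psi e -> obs_close psi phi e ->
  (forall k r, a / 2 <= k -> spread X k r -> r <= M) ->
  `|msize a X - msize a Y| <= e * (M + 2).
Proof.
move=> a0 e0 ea e1 M0 p1 p2 o1 o2 hM.
have h1 : msize a X <= msize a Y + e * (M + 1).
  by apply: msize_close_le o1 _ => // k r ak; apply: hM; lra.
have h2 : msize a Y <= msize a X + e * (M + 1 + 1).
  apply: (msize_close_le _ _ _ p2 p1 o2) => //; first lra.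
  move=> k r ak /(spread_close p2 p1 o2)/hM; lra.
by rewrite ler_norml; nra.
Qed.

(** Isomorphic spaces share their size set, so taking the union avoids choosing a representative. *)
Definition csize a (A : set (mmspace R)) : R := sup (\bigcup_(X in A) size_set a X).

Lemma csize_cls a X : csize a (cls X) = msize a X.
Proof.
congr sup; apply/seteqP; split => [z [Y XY]|z]; last by exists X => //; exact: mem_cls.
move=> [->|[k [r [ak r0 sp ->]]]]; [by left|right; exists k, r; split => //].
exact: spread_iso (mm_iso_sym XY) sp.
Qed.

Lemma csizeE a (A : set (mmspace R)) X : @isClass R A -> A X -> csize a A = msize a X.
Proof. by move=> cA AX; rewrite (clsP cA AX) csize_cls. Qed.

Lemma csize_act a t A : 0 < a -> 0 < t -> @isClass R A -> csize a (actC t A) = t * csize a A.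
Proof.
move=> a0 t0 [X ->]; have [Y tXY] := scale_exists X t0.
by rewrite (actC_cls t0 tXY) !csize_cls (msize_scaled a0 t0 tXY).
Qed.

Lemma csize_Estar a A : 0 < a -> @isClass R A -> 0 < csize a A -> @Estar R A.
Proof.
move=> a0 cA h; split => // -[X [AX pX]].
by move: h; rewrite (csizeE a cA AX) msize_point// ltxx.
Qed.

Lemma csize_exists A : @Estar R A -> exists2 a, 0 < a & 0 < csize a A.
Proof.
move=> [[X ->] nA]; have [|a a0 h] := @msize_exists X.
  by move=> pX; apply: nA; exists X; split => //; exact: mem_cls.
by exists a; rewrite ?csize_cls.
Qed.

End Size.

(** * Continuity of the scaling action *)

Section ActionContinuity.
Context {R : realType}.
Implicit Types (X Y : mmspace R) (s t r e : R).

Local Notation I := (@I01 R).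

(** The change of scale multiplies a distance that is bounded, by [2 * M], only while [phi] stays in
    the ball; the other times are discarded at cost [eta]. *)
Lemma box_close_scaled X Y X1 Y1 (f : mcar X -> mcar X1) (g : mcar Y -> mcar Y1)
    (phi : R -> mcar X) (psi : R -> mcar Y) s s' rho eta M e (x0 : mcar X) :
  0 < s -> 0 < s' -> 0 <= rho -> `|s - s'| <= rho ->
  (forall x x', mdist (f x) (f x') = s * mdist x x') ->
  (forall y y', mdist (g y) (g y') = s' * mdist y y') ->
  param phi -> mmeas (~` mball (@mdist R X) x0 M) <= eta ->
  rho + eta <= e -> (s + rho) * rho + rho * (2 * M) <= e ->
  box_close phi psi rho -> box_close (f \o phi) (g \o psi) e.
Proof.
move=> s0 s'0 rho0 ss' hf hg pphi hM h1 h2 [I0 [[mI0 I0I] lI0 hI0]].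
pose B := I `&` phi @^-1` (mball (@mdist R X) x0 M).
have mB : measurable B by have [] := pphi _ (measurable_ball x0 M).
have [_ lB] := pphi _ (measurable_ballC x0 M).
exists (I0 `&` B); split.
- by split; [exact: measurableI|move=> t [/I0I]].
- have : (leb I0 <= leb (I0 `&` B) + eta%:E)%E.
    apply: le_trans (leeD (lexx _) (_ : leb (I `&` phi @^-1` (~` mball (@mdist R X) x0 M)) <= _)%E).
      apply: le_trans (lebU _ _); apply: leb_mono => t I0t; have It := I0I _ I0t.
      by have [Bt|nBt] := pselect (mball (@mdist R X) x0 M (phi t)); [left|right].
    by rewrite lB lee_fin.
  move=> h; have {h} := le_trans lI0 h; rewrite -leeBlDr// -EFinB; apply: le_trans.
  by rewrite lee_fin; lra.
- move=> t t' [It [_ /= bt]] [It' [_ /= bt']]; rewrite /= hf hg.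
  rewrite /mball/= in bt bt'.
  have dM : mdist (phi t) (phi t') <= 2 * M.
    by have := mdist_tri (phi t) x0 (phi t'); rewrite (mdist_sym (phi t) x0); lra.
  have hd := hI0 t t' It It'.
  set d := mdist (phi t) _ in dM hd *; set d' := mdist (psi t) _ in hd *.
  have d0 : 0 <= d by exact: mdist_ge0.
  apply: le_trans h2.
  have -> : s * d - s' * d' = s' * (d - d') + (s - s') * d by ring.
  apply: le_trans (ler_normD _ _) _; rewrite !normrM (gtr0_norm s'0) (ger0_norm d0).
  have s's : s' <= s + rho by move: ss'; rewrite ler_norml; lra.
  by apply: lerD; apply: ler_pM => //; exact: ltW.
Qed.

Lemma nonexpansive_scale X X1 (f : mcar X -> mcar X1) s (u : mcar X1 -> R) : 0 < s ->
  (forall x x', mdist (f x) (f x') = s * mdist x x') ->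
  nonexpansive u -> nonexpansive (fun x => u (f x) / s).
Proof.
move=> s0 hf u1 x x'; rewrite -mulrBl normrM (gtr0_norm (_ : 0 < s^-1)) ?invr_gt0//.
by rewrite ler_pdivrMr// mulrC -hf; exact: u1.
Qed.

(** The constant [b] serves to recenter: the scale error then acts on [u - u x0], which is bounded
    on balls, instead of on [u]. *)
Lemma nonexpansive_unscale X X1 (f : mcar X -> mcar X1) s (v : mcar X -> R) b : 0 < s ->
  (forall y, exists x, f x = y) ->
  (forall x x', mdist (f x) (f x') = s * mdist x x') ->
  nonexpansive v -> exists2 w, nonexpansive w & forall x, w (f x) = s * v x + b.
Proof.
move=> s0 /choice[g fg] hf v1; exists (fun y => s * v (g y) + b).
  move=> y y'; rewrite opprD addrACA subrr addr0 -mulrBr normrM gtr0_norm//.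
  by rewrite -[in X in _ <= X](fg y) -[in X in _ <= X](fg y') hf ler_pM2l//.
move=> x; suff -> : g (f x) = x by [].
apply/mdist_sep/eqP; have := hf (g (f x)) x; rewrite fg mdist_refl => /esym/eqP.
by rewrite mulf_eq0 gt_eqF.
Qed.

Lemma leb_dev_scaled X Y (phi : R -> mcar X) (psi : R -> mcar Y) u v
    (F G : R -> R) s s' c rho eta M e (x0 : mcar X) :
  0 < s -> 0 < s' -> 0 <= rho -> `|s - s'| <= rho ->
  param phi -> mmeas (~` mball (@mdist R X) x0 M) <= eta ->
  rho + eta <= e -> (s + rho) * rho + rho * M <= e ->
  nonexpansive u -> c = u x0 ->
  (leb (dev (u \o phi) (v \o psi) rho) <= rho%:E)%E ->
  (forall t, F t - G t = s' * (u (phi t) - v (psi t)) + (s - s') * (u (phi t) - c)) ->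
  (leb (dev F G e) <= e%:E)%E.
Proof.
move=> s0 s'0 rho0 ss' pphi hM h1 h2 u1 -> hdev hFG.
have [_ lB] := pphi _ (measurable_ballC x0 M).
apply: (@le_trans _ _ (rho + eta)%:E); last by rewrite lee_fin.
rewrite EFinD; apply: le_trans (leeD hdev (_ : leb (I `&` phi @^-1` (~` mball (@mdist R X) x0 M)) <= _)%E); last first.
  by rewrite lB lee_fin.
apply: le_trans (lebU _ _); apply: leb_mono => t [It /= ht].
have [h|h] := ltP rho `|u (phi t) - v (psi t)|; first by left.
right; split => //= hb; move: ht; apply/negP; rewrite -leNgt; apply: le_trans h2.
rewrite hFG; apply: le_trans (ler_normD _ _) _; rewrite !normrM (gtr0_norm s'0).
have s's : s' <= s + rho by move: ss'; rewrite ler_norml; lra.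
apply: lerD; apply: ler_pM => //; first exact: ltW.
by apply: le_trans (u1 _ _) _; rewrite mdist_sym ltW.
Qed.

Lemma obs_close_scaled X Y X1 Y1 (f : mcar X -> mcar X1) (g : mcar Y -> mcar Y1)
    (phi : R -> mcar X) (psi : R -> mcar Y) s s' rho eta M e (x0 : mcar X) :
  0 < s -> 0 < s' -> 0 <= rho -> `|s - s'| <= rho ->
  (forall x, exists z, f z = x) -> (forall x x', mdist (f x) (f x') = s * mdist x x') ->
  (forall y, exists z, g z = y) -> (forall y y', mdist (g y) (g y') = s' * mdist y y') ->
  param phi -> mmeas (~` mball (@mdist R X) x0 M) <= eta ->
  rho + eta <= e -> (s + rho) * rho + rho * M <= e ->
  obs_close phi psi rho -> obs_close psi phi rho ->
  obs_close (f \o phi) (g \o psi) e /\ obs_close (g \o psi) (f \o phi) e.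
Proof.
move=> s0 s'0 rho0 ss' sf hf sg hg pphi hM h1 h2 o1 o2; split => w w1.
  have u1 := nonexpansive_scale s0 hf w1; set u := (fun x => _) in u1.
  have [v v1 hv] := o1 u u1.
  have [w' w'1 hw'] := nonexpansive_unscale ((s - s') * u x0) s'0 sg hg v1.
  exists w' => //.
  apply: (leb_dev_scaled s0 s'0 rho0 ss' pphi hM h1 h2 u1 erefl hv) => t /=.
  by rewrite hw' -[w _](divfK (lt0r_neq0 s0)) -/(u _); ring.
have v1 := nonexpansive_scale s'0 hg w1; set v := (fun x => _) in v1.
have [u u1] := o2 v v1; rewrite dev_sym => hv.
have [w' w'1 hw'] := nonexpansive_unscale ((s' - s) * u x0) s0 sf hf u1.
exists w' => //; rewrite dev_sym.
apply: (leb_dev_scaled s0 s'0 rho0 ss' pphi hM h1 h2 u1 erefl hv) => t /=.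
by rewrite hw' -[w _](divfK (lt0r_neq0 s'0)) -/(v _); ring.
Qed.

(** What the bundle argument uses of either distance. The last field is joint continuity of the
    action at (s, X), with a radius valid for every representative of the class of [X]. *)
Record admissible (delta : mmspace R -> mmspace R -> R) : Prop := {
  admissible_ge0 : forall X Y, 0 <= delta X Y;
  admissible_obs : forall X Y e, delta X Y < e -> exists phi psi,
    [/\ @param R X phi, @param R Y psi, obs_close phi psi e & obs_close psi phi e];
  admissible_box : forall X Y (phi : R -> mcar X) (psi : R -> mcar Y) e, 0 <= e ->
    param phi -> param psi -> box_close phi psi e -> delta X Y <= e;
  admissible_act : forall X s r, 0 < s -> 0 < r -> exists2 rho, 0 < rho &
    forall X' Y s' X1 Y1, mm_iso X X' -> 0 < s' -> delta X' Y < rho ->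
      `|s - s'| < rho -> mm_iso_scaled s X' X1 -> mm_iso_scaled s' Y Y1 ->
      delta X1 Y1 < r }.

Lemma scaling_radius s r M : 0 < s -> 0 < r -> 0 <= M -> exists2 rho, 0 < rho &
  rho + r / 4 <= r / 2 /\ (s + rho) * rho + rho * (2 * M) <= r / 2.
Proof.
move=> s0 r0 M0; pose q := 4 * (s + 2 * M + 2).
have q0 : 0 < q by rewrite /q; lra.
pose rho := Num.min 1 (r / q).
have rho0 : 0 < rho by rewrite lt_min ltr01 divr_gt0.
have rho1 : rho <= 1 by rewrite ge_min lexx.
have : rho <= r / q by rewrite ge_min lexx orbT.
rewrite ler_pdivlMr// /q => hq; exists rho => //; split; nra.
Qed.

(** Lets a radius [M] chosen for one space serve its whole class. *)
Lemma ball_mass_iso X X' (x0 : mcar X) M : mm_iso X X' -> exists x0' : mcar X',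
  mmeas (~` mball (@mdist R X') x0' M) = mmeas (~` mball (@mdist R X) x0 M).
Proof.
move=> [f [f1 [f2 f3]]]; exists (f x0); rewrite f3; last exact: measurable_ballC.
by congr mmeas; apply/seteqP; split => x; rewrite /mball/= f2.
Qed.

Lemma box_admissible : admissible (@boxdist R).
Proof.
split.
- exact: boxdist_ge0.
- move=> X Y e /boxdist_lt[phi [psi [p1 p2 bc]]]; exists phi, psi; split => //.
    exact: box_obs_close.
  exact/box_obs_close/box_close_sym.
- exact: boxdist_le.
move=> X s r s0 r0.
have r4 : 0 < r / 4 by lra.
have [x0 _] := mcar_inhabited X; have [M M0 hM] := ball_mass x0 r4.
have [rho rho0 [h1 h2]] := scaling_radius s0 r0 M0; exists rho => //.
move=> X' Y s' X1 Y1 XX' s'0 /boxdist_lt[phi [psi [p1 p2 bc]]] /ltW ss'.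
move=> [f [f1 [f2 f3]]] [g [g1 [g2 g3]]].
have [x0' hM'] := ball_mass_iso x0 M XX'; rewrite -hM' in hM.
apply: (@le_lt_trans _ _ (r / 2)); last lra.
apply: (@boxdist_le _ _ _ (f \o phi) (g \o psi)); first lra.
- exact: param_scaled (ltW s0) f2 f3 p1.
- exact: param_scaled (ltW s'0) g2 g3 p2.
- exact: box_close_scaled s0 s'0 (ltW rho0) ss' f2 g2 p1 hM h1 h2 bc.
Qed.

Lemma conc_admissible : admissible (@concdist R).
Proof.
split.
- exact: concdist_ge0.
- by move=> X Y e /concdist_lt[phi [psi [p1 p2 o1 o2]]]; exists phi, psi.
- move=> X Y phi psi e e0 p1 p2 bc; apply: (concdist_le e0 p1 p2); first exact: box_obs_close.
  exact/box_obs_close/box_close_sym.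
move=> X s r s0 r0.
have r4 : 0 < r / 4 by lra.
have [x0 _] := mcar_inhabited X; have [M M0 hM] := ball_mass x0 r4.
have [rho rho0 [h1 h2]] := scaling_radius s0 r0 M0; exists rho => //.
have h3 : (s + rho) * rho + rho * M <= r / 2 by nra.
move=> X' Y s' X1 Y1 XX' s'0 /concdist_lt[phi [psi [p1 p2 o1 o2]]] /ltW ss'.
move=> [f [f1 [f2 f3]]] [g [g1 [g2 g3]]].
have [x0' hM'] := ball_mass_iso x0 M XX'; rewrite -hM' in hM.
have [oc1 oc2] := obs_close_scaled s0 s'0 (ltW rho0) ss' f1 f2 g1 g2 p1 hM h1 h3 o1 o2.
apply: (@le_lt_trans _ _ (r / 2)); last lra.
apply: (concdist_le _ _ _ oc1 oc2); first lra.
- exact: param_scaled (ltW s0) f2 f3 p1.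
- exact: param_scaled (ltW s'0) g2 g3 p2.
Qed.

End ActionContinuity.

(** * The bundle *)

Section Bundle.
Context {R : realType} (delta : mmspace R -> mmspace R -> R).
Hypothesis adm : admissible delta.
Implicit Types (X Y : mmspace R) (A B : set (mmspace R)) (s t r a : R).

Lemma clsdist_lbound A B : has_lbound [set delta X Y | X in A & Y in B].
Proof. by exists 0 => _ [X AX [Y BY <-]]; exact: (admissible_ge0 adm). Qed.

Lemma clsdist_lt A B r : isClass A -> isClass B -> clsdist delta A B < r ->
  exists X Y, [/\ A X, B Y & delta X Y < r].
Proof.
move=> [X ->] [Y ->] /inf_lt[|_ [X' XX' [Y' YY' <-]] h].
  by exists (delta X Y), X; [exact: mem_cls|exists Y => //; exact: mem_cls].
by exists X', Y'.
Qed.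

Lemma clsdist_le A B X Y : A X -> B Y -> clsdist delta A B <= delta X Y.
Proof.
by move=> AX BY; apply: ge_inf; [exact: clsdist_lbound|exists X => //; exists Y].
Qed.

Lemma clsdist_refl A : isClass A -> clsdist delta A A <= 0.
Proof.
move=> [X ->]; apply: le_trans (clsdist_le (mem_cls X) (mem_cls X)) _.
have [phi pphi] := param_exists X.
apply: (admissible_box adm (lexx 0) pphi pphi).
exists (@I01 R); split => [|| t t' _ _]; last by rewrite subrr normr0.
  by split => //; exact: measurable_I01.
by rewrite subr0 leb_I01.
Qed.

Lemma csize_cont a A (e : R) : 0 < a -> 0 < e -> isClass A ->
  exists2 r, 0 < r & forall B, isClass B -> clsdist delta A B < r ->
    `|csize a A - csize a B| < e.
Proof.
move=> a0 e0 cA; have [X eA] := cA.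
have [|M M0 hM] := @spread_bound R X (a / 2); first lra.
(* [msize_close] has the factor [M + 2]; the extra 1 yields a strict inequality. *)
pose q := e / (M + 3).
have q0 : 0 < q by rewrite divr_gt0//; lra.
pose r := Num.min (Num.min 1 (a / 2)) q.
have r1 : r <= 1 by rewrite !ge_min lexx.
have r2 : r <= a / 2 by rewrite !ge_min lexx orbT.
have r3 : r <= q by rewrite ge_min lexx orbT.
have r0 : 0 < r by rewrite !lt_min ltr01 q0 andbT; lra.
exists r => // B cB /(clsdist_lt cA cB)[X' [Y [AX' BY /(admissible_obs adm)]]].
move=> [phi [psi [p1 p2 o1 o2]]].
rewrite (csizeE a cA AX') (csizeE a cB BY).
have XX' : mm_iso X X' by rewrite eA in AX'.
have hM' k r' : a / 2 <= k -> spread X' k r' -> r' <= M.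
  by move=> ak /(spread_iso (mm_iso_sym XX')); exact: hM.
apply: le_lt_trans (msize_close a0 (ltW r0) r2 r1 M0 p1 p2 o1 o2 hM') _.
by move: r3; rewrite /q ler_pdivlMr; nra.
Qed.

Lemma act_cont A s (U : set (set (mmspace R))) : isClass A -> 0 < s -> openX delta U ->
  U (actC s A) -> exists2 rho, 0 < rho & forall B s', isClass B ->
    clsdist delta A B < rho -> `|s - s'| < rho -> 0 < s' -> U (actC s' B).
Proof.
move=> cA s0 [_ oU] /oU[r r0 hr]; have [X eA] := cA.
have [rho rho0 h] := admissible_act adm X s0 r0; exists rho => // B s' cB.
move=> /(clsdist_lt cA cB)[X' [Y [AX' BY hd]]] ss' s'0.
apply: hr; first exact: isClass_act.
have [X1 sX1] := scale_exists X' s0; have [Y1 sY1] := scale_exists Y s'0.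
have XX' : mm_iso X X' by rewrite eA in AX'.
apply: le_lt_trans (h _ _ _ _ _ XX' s'0 hd ss' sX1 sY1).
rewrite (clsP cA AX') (clsP cB BY) (actC_cls s0 sX1) (actC_cls s'0 sY1).
by apply: clsdist_le; exact: mem_cls.
Qed.

Lemma ropen_interval (x e : R) : ropen [set y : R | `|y - x| < e].
Proof.
move=> y /= h; exists (e - `|y - x|); first by rewrite subr_gt0.
by move=> z hz /=; have := ler_distD y z x; lra.
Qed.

Lemma openX_csize a (W : set R) : 0 < a -> ropen W ->
  openX delta [set A | isClass A /\ W (csize a A)].
Proof.
move=> a0 oW; split=> [A []//|A [cA WA]]; have [e e0 eW] := oW _ WA.
have [r r0 hr] := csize_cont a0 e0 cA; exists r => // B cB /(hr B cB) h.
by split => //; apply: eW; rewrite distrC.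
Qed.

Lemma bundle_free : @free_action R.
Proof.
move=> A eA t t0 tA; have [a a0 h] := csize_exists eA.
have := csize_act a0 t0 eA.1; rewrite tA => /eqP.
by rewrite -[X in X == _]mul1r => /eqP/(mulIf (lt0r_neq0 h)).
Qed.

Lemma ratio_cont (c q e : R) : 0 < c -> 0 < q -> 0 < e ->
  (* Here [x > c / 2], and [y - q * x] is below [d * (1 + q) <= e * c / 2] in absolute value. *)
  exists2 d, 0 < d & forall x y, `|x - c| < d -> `|y - q * c| < d ->
    0 < x /\ `|y / x - q| < e.
Proof.
move=> c0 q0 e0; pose d := Num.min (c / 2) (e * c / (2 * (1 + q))).
have d1 : d <= c / 2 by rewrite ge_min lexx.
have d2 : d * (1 + q) <= e * c / 2.
  have : d <= e * c / (2 * (1 + q)) by rewrite ge_min lexx orbT.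
  by rewrite ler_pdivlMr; lra.
exists d; first by rewrite lt_min !divr_gt0 ?mulr_gt0//; lra.
move=> x y; rewrite !ltr_norml => /andP[x1 x2] /andP[y1 y2].
have x0 : 0 < x by lra.
have -> : y / x - q = (y - q * x) / x by rewrite mulrBl mulfK// gt_eqF.
split => //; apply/andP; split.
  by rewrite ltr_pdivlMr//; nra.
by rewrite ltr_pdivrMr//; nra.
Qed.

(** At a level [a] where the first class has positive size, [tau] is the quotient of the two sizes,
    and this persists nearby. *)
Lemma bundle_translation : translation_continuous delta.
Proof.
have /choice[tau htau] : forall p : set (mmspace R) * set (mmspace R),
    exists t, fiber_pairs p -> 0 < t /\ p.2 = actC t p.1.
  move=> p; have [[e1 e2 e12]|nf] := pselect (fiber_pairs p); last by exists 1.
  by have [t t0 ->] := piS_eq e2.1 e12; exists t.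
exists tau; split => // V oV.
(* The union of all open boxes on whose fiber pairs [tau] stays in [V]. *)
exists [set q | exists U1 U2, [/\ openX delta U1, openX delta U2, U1 q.1, U2 q.2 &
  forall p, fiber_pairs p -> U1 p.1 -> U2 p.2 -> V (tau p)]]; split.
  move=> q [U1 [U2 [ou1 ou2 u1 u2 h]]]; exists U1, U2; split => // x y ux uy.
  by exists U1, U2.
move=> p fp; split=> [[U1 [U2 [ou1 ou2 u1 u2 h]]]|Vp]; first exact: h.
have [e e0 eV] := oV _ Vp; have [t0 ep2] := htau p fp.
have [[c1 n1] [c2 n2] _] := fp.
have [a a0 h] := csize_exists (conj c1 n1).
have [d d0 hd] := ratio_cont h t0 e0.
pose W x := [set B | isClass B /\ [set y : R | `|y - x| < d] (csize a B)].
have oW x : openX delta (W x) by apply: openX_csize => //; exact: ropen_interval.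
exists (W (csize a p.1)), (W (csize a p.2)); split => //.
- by split => //=; rewrite subrr normr0.
- by split => //=; rewrite subrr normr0.
rewrite ep2 csize_act// => p' fp' [_ /= w1] [_ /= w2]; apply: eV.
have [x0 hx] := hd _ _ w1 w2; have [t'0 ep'2] := htau p' fp'.
have [[c1' _] _ _] := fp'.
by move: hx; rewrite ep'2 csize_act// mulfK// gt_eqF.
Qed.

Definition chart a : set (set (set (mmspace R))) :=
  [set b | exists A, [/\ Estar A, 0 < csize a A & b = piS A]].

Lemma csize_eq_fiber a A B : 0 < a -> Estar A -> Estar B -> piS A = piS B ->
  0 < csize a A -> csize a A = csize a B -> A = B.
Proof.
move=> a0 eA eB AB h; have [t t0 ->] := piS_eq eB.1 AB.
rewrite csize_act//; last exact: eA.1.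
move=> /eqP; rewrite -[X in X == _]mul1r => /eqP/(mulIf (lt0r_neq0 h)) <-.
by rewrite actC1//; exact: eA.1.
Qed.

Lemma chart_piS a A : 0 < a -> Estar A -> chart a (piS A) <-> 0 < csize a A.
Proof.
move=> a0 eA; split=> [[B [eB h AB]]|h]; last by exists A.
have [t t0 ->] := piS_eq eA.1 (esym AB); rewrite csize_act//; last exact: eB.1.
exact: mulr_gt0.
Qed.

Lemma ropen_gt0 : ropen [set x : R | 0 < x].
Proof.
move=> x /= x0; exists x => // y; rewrite ltr_norml => /andP[h _] /=; lra.
Qed.

Lemma openS_chart a : 0 < a -> openS delta (chart a).
Proof.
move=> a0; split=> [b [A [eA _ ->]]|]; first by exists A.
exists [set A | isClass A /\ [set x : R | 0 < x] (csize a A)].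
split; first by apply: openX_csize => //; exact: ropen_gt0.
move=> A eA; rewrite (chart_piS a0 eA) /=; split=> [[]//|h].
by split => //; exact: eA.1.
Qed.

(** [actC (s / csize a A) A] is the point of size [s] in the fiber of [A]; it depends continuously
    on [A] and [s]. *)
Lemma normalized_cont a A s (V : set (set (mmspace R))) : 0 < a -> isClass A ->
  0 < csize a A -> 0 < s -> openX delta V -> V (actC (s / csize a A) A) ->
  exists2 rho, 0 < rho & forall B s', isClass B -> clsdist delta A B < rho ->
    `|s' - s| < rho -> 0 < s' -> V (actC (s' / csize a B) B).
Proof.
move=> a0 cA h s0 oV VA; have q0 : 0 < s / csize a A by exact: divr_gt0.
have [r r0 hr] := act_cont cA q0 oV VA.
have [d d0 hd] := ratio_cont h q0 r0.
have [r' r'0 hr'] := csize_cont a0 d0 cA.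
exists (Num.min r (Num.min r' d)); first by rewrite !lt_min r0 r'0.
move=> B s' cB; rewrite !lt_min => /and3P[b1 b2 b3] /and3P[s1 s2 s3] s'0.
have [||x0 hx] := hd (csize a B) s'.
- by rewrite distrC; exact: hr'.
- by rewrite divfK// gt_eqF.
by apply: hr => //; [rewrite distrC|exact: divr_gt0].
Qed.

(** Classes whose fiber meets the sizes in [s - d, s + d] inside [V] only. The condition is scale
    invariant, so for an open tube the image in [Sigma] is open. *)
Definition tube a s d (V : set (set (mmspace R))) : set (set (mmspace R)) :=
  [set A | [/\ isClass A, 0 < csize a A &
     forall s', s - d <= s' <= s + d -> V (actC (s' / csize a A) A)]].

Lemma openX_tube a s d V : 0 < a -> d < s -> openX delta V ->
  openX delta (tube a s d V).
Proof.
move=> a0 ds oV; split=> [A []//|A [cA h hV]].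
have [r0 r00 hr0] := csize_cont a0 h cA.
pose P (r : R) (s' : R) := forall B, isClass B -> clsdist delta A B < r ->
  V (actC (s' / csize a B) B).
have cK := @segment_compact R (s - d) (s + d).
(* Each scale has its own radius; compactness, in its near-covering form over radii tending to 0,
   gives one radius for all scales. *)
move/compact_near_coveringP : cK => /(_ _ (0^'+ : set_system R) P _) nc.
have : \forall r \near (0 : R)^'+, `[s - d, s + d]%classic `<=` P r.
  apply: nc => s' ks'; have ks'' : s - d <= s' <= s + d by move: ks'; rewrite /= in_itv.
  have s'0 : 0 < s' by move: ks'' => /andP[]; lra.
  have [rho rho0 hrho] := normalized_cont a0 cA h s'0 oV (hV _ ks').
  have m0 : 0 < Num.min rho s' by rewrite lt_min rho0.
  exists (ball s' (Num.min rho s'), [set r | r < rho]) => /=.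
    split; first exact: nbhsx_ballx.
    exact: nbhs_right_lt.
  move=> [s1 r] /= [hs1 hr] B cB hB; apply: hrho => //.
  - exact: lt_trans hr.
  - by move: hs1; rewrite /ball/= lt_min distrC => /andP[].
  - by move: hs1; rewrite /ball/= lt_min => /andP[_]; rewrite ltr_norml => /andP[]; lra.
move=> hn; have : \forall r \near (0 : R)^'+, 0 < r /\ `[s - d, s + d]%classic `<=` P r.
  near=> r; split; last by near: r.
  by near: r; exact: nbhs_right_gt.
move=> /filter_ex[r [r_gt0 hP]].
exists (Num.min r r0); first by rewrite lt_min r_gt0.
move=> B cB; rewrite lt_min => /andP[b1 b2]; split => //.
  by have := hr0 B cB b2; rewrite ltr_norml => /andP[_]; lra.
by move=> s' ks'; apply: hP => //=; rewrite in_itv.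
Unshelve. all: by end_near. Qed.

(** Fiber and size are the coordinates; the inverse [g] picks the unique point of given size in a
    fiber. *)
Lemma bundle_chart a : 0 < a -> trivialization delta (chart a).
Proof.
move=> a0.
have /choice[g hg] : forall p : set (set (mmspace R)) * R, exists A,
    chart a p.1 /\ 0 < p.2 -> [/\ Estar A, piS A = p.1 & csize a A = p.2].
  move=> p; have [[[A [eA h ->]] p0]|n] := pselect (chart a p.1 /\ 0 < p.2); last first.
    by exists set0.
  have t0 : 0 < p.2 / csize a A by exact: divr_gt0.
  exists (actC (p.2 / csize a A) A) => _; split; first exact: Estar_act.
    by rewrite piS_act//; exact: eA.1.
  by rewrite csize_act//; [rewrite divfK// gt_eqF|exact: eA.1].
exists (fun A => (piS A, csize a A)), g.
have D_csize A : Estar A /\ chart a (piS A) -> 0 < csize a A.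
  by move=> [eA /(chart_piS a0 eA)].
have D_g p : chart a p.1 /\ 0 < p.2 -> Estar (g p) /\ chart a (piS (g p)).
  by move=> hp; have [e1 e2 e3] := hg p hp; split => //; rewrite e2; case: hp.
split; split.
- by move=> A DA; split => /=; [case: DA|exact: D_csize].
- exact: D_g.
- move=> A DA; have hA := D_csize A DA.
  have [|e1 e2 e3] := hg (piS A, csize a A); first by split => //; case: DA.
  apply: (csize_eq_fiber a0 e1) => //; first by case: DA.
  by rewrite e3.
- by move=> p hp; have [e1 e2 e3] := hg p hp; rewrite e2 e3; case: (p).
- move=> V oV; exists [set A | [/\ Estar A, chart a (piS A) & V (piS A, csize a A)]].
  split; last by move=> A [eA cA]; split=> [[]//|]; split.
  split=> [A [[]]//|A [eA cA VA]].
  have [U [W [[US [N [[Ncl oN] hN]]] oW /= UA WA UWV]]] := oV _ VA.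
  have [r1 r10 h1] := oN A ((hN A eA).2 UA).
  have := openX_csize a0 oW => -[_ oW'].
  have [r2 r20 h2] := oW' A (conj eA.1 WA).
  (* Positive size keeps nearby classes away from the one-point space, where [N] is not controlled
     by [US]. *)
  have := openX_csize a0 ropen_gt0 => -[_ oP].
  have [r3 r30 h3] := oP A (conj eA.1 ((chart_piS a0 eA).1 cA)).
  exists (Num.min r1 (Num.min r2 r3)); first by rewrite !lt_min r10 r20.
  move=> B cB; rewrite !lt_min => /and3P[b1 b2 b3].
  have [_ /= B0] := h3 B cB b3.
  have eB : Estar B by exact: csize_Estar B0.
  split => //; first exact/chart_piS.
  by apply: UWV; [apply/hN => //; exact: h1|case: (h2 B cB b2)].
- move=> V oV; exists [set p | (chart a p.1 /\ 0 < p.2) /\ V (g p)].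
  split; last by move=> p Dp; split=> [[]//|].
  move=> [b s] [Dp Vp]; have [e1 e2 e3] := hg _ Dp; rewrite /= in e2 e3.
  set A := g (b, s) in Vp e1 e2 e3; have [/= cb s0] := Dp.
  have A0 : 0 < csize a A by rewrite e3.
  have [|rho rho0 hrho] := normalized_cont a0 e1.1 A0 s0 oV.
    by rewrite e3 divff ?gt_eqF// actC1//; exact: e1.1.
  pose d := Num.min rho s / 2.
  have m0 : 0 < Num.min rho s by rewrite lt_min rho0.
  have m1 : Num.min rho s <= rho by rewrite ge_min lexx.
  have m2 : Num.min rho s <= s by rewrite ge_min lexx orbT.
  have d0 : 0 < d by rewrite /d; lra.
  have ds : d < s by rewrite /d; lra.
  have dr : d < rho by rewrite /d; lra.
  pose T := tube a s d V.
  have TA : T A.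
    split => //; [exact: e1.1|move=> s' /andP[s1 s2]].
    apply: hrho; [exact: e1.1| |rewrite ltr_norml; lra|lra].
    by apply: le_lt_trans (clsdist_refl e1.1) _.
  exists [set b' | exists B, [/\ Estar B, T B & b' = piS B]], [set s' | `|s' - s| < d].
  split.
  + split=> [b' [B [eB _ ->]]|]; first by exists B.
    exists T; split; first exact: openX_tube.
    (* Saturation of the tube: replacing [C] by [actC t C] multiplies its size by [t], so the
       normalized points are unchanged. *)
    move=> B eB; split=> [TB|[C [eC [_ C0 hC] BC]]]; first by exists B.
    have [t t0 ->] := piS_eq eB.1 (esym BC).
    have t_n0 : t != 0 by rewrite gt_eqF.
    split; [exact: (isClass_act t0 eC.1)|by rewrite csize_act ?mulr_gt0//; exact: eC.1|].
    move=> s' ks'; have s'0 : 0 < s' by move: ks' => /andP[]; lra.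
    rewrite csize_act//; last exact: eC.1.
    rewrite actCM//; [|by rewrite !divr_gt0// mulr_gt0|exact: eC.1].
    rewrite (_ : s' / (t * csize a C) * t = s' / csize a C); first exact: hC.
    by rewrite invfM mulrA -mulrA [_^-1 * t]mulrC !mulrA mulfVK.
  + exact: ropen_interval.
  + by exists A.
  + by rewrite /= subrr normr0.
  move=> _ s' [B [eB [_ B0 hB] ->]] /=; rewrite ltr_norml => hs'.
  have s'0 : 0 < s' by lra.
  have Dp' : chart a (piS B) /\ 0 < s' by split => //; apply/chart_piS.
  split => //; have [f1 f2 f3] := hg (piS B, s') Dp'; rewrite /= in f2 f3.
  have q0 : 0 < s' / csize a B by exact: divr_gt0.
  rewrite (_ : g _ = actC (s' / csize a B) B).
    by apply: hB; lra.
  apply: (csize_eq_fiber a0 f1) => //; first exact: Estar_act.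
  + by rewrite f2 piS_act//; exact: eB.1.
  + by rewrite f3.
  + by rewrite f3 csize_act ?divfK ?gt_eqF//; exact: eB.1.
- by [].
- by move=> A t [eA _] t0; rewrite piS_act ?csize_act//; exact: eA.1.
Qed.

Lemma bundle_locally_trivial : locally_trivial delta.
Proof.
move=> _ [A eA ->]; have [a a0 h] := csize_exists eA.
exists (chart a); split; [exact: openS_chart|by exists A|exact: bundle_chart].
Qed.

End Bundle.

(** * Nontriviality *)

(* The carrier lives in [Set] because universe constraints forbid [mcar X] to be
   the sort of an arbitrary [finType]; points are enumerated by [enum], of which
   [enum i] carries the mass [w i]. *)
Section FiniteSpace.
Context {R : realType} (T : Set) (p : nat) (enum : nat -> T).
Variables (d : T -> T -> R) (w : nat -> R).
Hypotheses (enum_surj : forall x, exists2 i, (i < p)%N & enum i = x)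
  (d_refl : forall x, d x x = 0) (d_sym : forall x y, d x y = d y x)
  (d_tri : forall x y z, d x z <= d x y + d y z)
  (d_ge1 : forall x y, x <> y -> 1 <= d x y)
  (w_gt0 : forall i, 0 < w i) (w_sum : \sum_(i < p) w i = 1).

Definition fin_meas (A : set T) : R := \sum_(i < p) if `[< A (enum i) >] then w i else 0.

Let d_lt1 x y : d x y < 1 -> x = y.
Proof. by move=> h; apply: contrapT => /d_ge1; rewrite leNgt h. Qed.

Let d_sep x y : d x y = 0 -> x = y.
Proof. by move=> h; apply: d_lt1; rewrite h. Qed.

Let fin_complete (u : nat -> T) :
  (forall e : R, 0 < e -> exists N, forall m n, (N <= m)%N -> (N <= n)%N ->
      d (u m) (u n) < e) ->
  exists l, forall e : R, 0 < e -> exists N, forall n, (N <= n)%N -> d (u n) l < e.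
Proof.
move=> /(_ 1 ltr01)[N hN]; exists (u N) => e e0; exists N => n Nn.
by rewrite (d_lt1 (hN n N Nn (leqnn N))) d_refl.
Qed.

Let fin_separable : exists D : nat -> T, forall x (e : R), 0 < e -> exists k, d x (D k) < e.
Proof.
by exists enum => x e e0; have [i _ <-] := enum_surj x; exists i; rewrite d_refl.
Qed.

Let term_ge0 (A : set T) i : 0 <= if `[< A (enum i) >] then w i else 0.
Proof. by case: ifP => // _; exact: ltW. Qed.

Let fin_meas_ge0 (A : set T) : 0 <= fin_meas A.
Proof. by apply: sumr_ge0 => i _; exact: term_ge0. Qed.

Let fin_meas_set0 : fin_meas set0 = 0.
Proof. by rewrite /fin_meas big1// => i _; rewrite asboolF. Qed.

Let fin_meas_setT : fin_meas setT = 1.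
Proof. by rewrite -w_sum /fin_meas; apply: eq_bigr => i _; rewrite asboolT. Qed.

(** Each atom lies in at most one [F k]; beyond the largest of these finitely many indices the
    partial sums equal the mass of the union. *)
Let fin_meas_sigma (F : nat -> set T) :
  (forall i j, i <> j -> F i `&` F j = set0) ->
  forall e : R, 0 < e -> exists N, forall m, (N <= m)%N ->
    `| \sum_(0 <= k < m) fin_meas (F k) - fin_meas (\bigcup_k F k) | < e.
Proof.
move=> tF e e0.
have /choice[K hK] : forall i, exists k, (\bigcup_k F k) (enum i) -> F k (enum i).
  move=> i; have [[k _ Fk]|n] := pselect ((\bigcup_k F k) (enum i)); last by exists 0%N.
  by exists k.
exists (\max_(i < p) (K i).+1)%N => m Nm.
rewrite (_ : \sum_(0 <= k < m) _ = fin_meas (\bigcup_k F k)) ?subrr ?normr0//.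
rewrite /fin_meas big_mkord exchange_big /=; apply: eq_bigr => i _.
case: asboolP => [iF|iF]; last first.
  by rewrite big1// => k _; rewrite asboolF// => Fk; apply: iF; exists k.
have Fi := hK i iF.
have Km : (K i < m)%N.
  by apply: leq_trans Nm; exact: (@leq_bigmax _ (fun i : 'I_p => (K i).+1)).
rewrite (bigD1 (Ordinal Km))//= asboolT// big1 ?addr0// => k kK.
rewrite asboolF// => Fk; move/eqP: kK; apply; apply: val_inj => /=.
by apply: contrapT => /tF/seteqP[/(_ (enum i)) + _]; apply.
Qed.

Let fin_supp x (r : R) : 0 < r -> 0 < fin_meas (mball d x r).
Proof.
move=> r0; have [i ip ix] := enum_surj x.
rewrite /fin_meas (bigD1 (Ordinal ip))//= asboolT; last by rewrite /mball/= ix d_refl.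
by rewrite ltr_pwDl// sumr_ge0.
Qed.

Definition fin_space : mmspace R := @MMSpace R T d d_refl d_sep d_sym d_tri fin_complete
  fin_separable fin_meas (fun A _ => fin_meas_ge0 A) fin_meas_set0 fin_meas_setT
  (fun F _ => @fin_meas_sigma F) fin_supp.

Lemma fin_space_borel (A : set (mcar fin_space)) : mborel (@mdist R fin_space) A.
Proof.
apply: (@mopen_borel R fin_space) => x Ax; exists 1 => // y; rewrite /mball/= => /d_lt1 <-.
exact: Ax.
Qed.

End FiniteSpace.

Section Nontrivial.
Context {R : realType}.
Implicit Types (q L : R).

Definition two_dist (x y : bool) : R := (x != y)%:R.

(** [enum] may repeat points, whose masses then add up; so a two-point space can carry the three
    weights of a three-point one. *)
Lemma two_space p (enum : nat -> bool) (w : nat -> R) :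
  (forall x, exists2 i, (i < p)%N & enum i = x) ->
  (forall i, 0 < w i) -> \sum_(i < p) w i = 1 ->
  exists Z : mmspace R, exists f : bool -> mcar Z,
  [/\ forall x y, mdist (f x) (f y) = two_dist x y,
      ~ is_point Z &
      forall B, mmeas B = fin_meas p enum w (f @^-1` B)].
Proof.
move=> en w1 w2.
have d1 x : two_dist x x = 0 by rewrite /two_dist eqxx.
have d2 x y : two_dist x y = two_dist y x by rewrite /two_dist eq_sym.
have d3 x y z : two_dist x z <= two_dist x y + two_dist y z.
  by case: x y z => [] [] []; rewrite /two_dist/=; lra.
have d4 x y : x <> y -> 1 <= two_dist x y by rewrite /two_dist => /eqP->.
exists (fin_space en d1 d2 d3 d4 w1 w2), id; split => //.
by move=> /(_ true false).
Qed.

Definition three_dist L (x y : option bool) : R :=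
  match x, y with
  | Some a, Some b => two_dist a b
  | None, None => 0
  | _, _ => L
  end.

Definition three_enum (i : nat) : option bool :=
  match i with 0 => None | 1 => Some true | _ => Some false end.

(** The far point [None] takes its mass from [Some true], so merging these two restores equal
    masses. *)
Definition three_weight q (i : nat) : R :=
  match i with 0 => q | 1 => 2^-1 - q | _ => 2^-1 end.

Lemma three_weight_gt0 q i : 0 < q < 2^-1 -> 0 < three_weight q i.
Proof. by move=> /andP[q0 q1]; case: i => [|[|i]] //=; lra. Qed.

Lemma three_weight_sum q : \sum_(i < 3) three_weight q i = 1.
Proof. by rewrite !big_ord_recl big_ord0 /=; lra. Qed.

Lemma three_space q L : 0 < q < 2^-1 -> 1 <= L ->
  exists Y : mmspace R, exists f : mcar Y -> option bool,
  [/\ forall x y, mdist x y = three_dist L (f x) (f y),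
      ~ is_point Y,
      forall B, mborel (@mdist R Y) B &
      forall C, @mmeas R Y (f @^-1` C) = fin_meas 3 three_enum (three_weight q) C].
Proof.
move=> hq L1.
have en x : exists2 i, (i < 3)%N & three_enum i = x.
  by case: x => [[]|]; [exists 1%N|exists 2%N|exists 0%N].
have d1 x : three_dist L x x = 0 by case: x => [a|]//; rewrite /= /two_dist eqxx.
have d2 x y : three_dist L x y = three_dist L y x.
  by case: x y => [a|] [b|]//=; rewrite /two_dist eq_sym.
have d3 x y z : three_dist L x z <= three_dist L x y + three_dist L y z.
  by case: x y z => [[]|] [[]|] [[]|]; rewrite /= /two_dist/=; lra.
have d4 x y : x <> y -> 1 <= three_dist L x y.
  by case: x y => [[]|] [[]|]//=; rewrite /two_dist/=.
exists (fin_space en d1 d2 d3 d4 (fun i => three_weight_gt0 i hq) (three_weight_sum q)), id.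
by split => // [/(_ None (Some true))//|B]; exact: fin_space_borel.
Qed.

Lemma param_map (X Y : mmspace R) (f : mcar X -> mcar Y) (phi : R -> mcar X) :
  (forall B, mborel (@mdist R X) B) ->
  (forall B, mborel (@mdist R Y) B -> mmeas B = mmeas (f @^-1` B)) ->
  param phi -> param (f \o phi).
Proof. by move=> bX hf pphi B mB; rewrite hf// comp_preimage; exact: pphi. Qed.

Variables (delta : mmspace R -> mmspace R -> R) (adm : admissible delta).

(** [F] is the scale coordinate of the trivialization; continuity is tested on products of [Sigma]
    with an interval. *)
Lemma trivial_bundle_section : trivial_bundle delta ->
  exists F : set (mmspace R) -> R,
  [/\ forall A, Estar A -> 0 < F A,
      forall A t, Estar A -> 0 < t -> F (actC t A) = t * F A &
      forall A (e : R), Estar A -> 0 < e -> exists2 r, 0 < r &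
        forall B, Estar B -> clsdist delta A B < r -> `|F B - F A| < e].
Proof.
move=> [h [g [[h1 _ _ _] [h2 _ h3 h4]]]].
have DE (A : set (mmspace R)) : Estar A -> Estar A /\ Sigma (piS A) by move=> eA; split => //; exists A.
exists (fun A => (h A).2); split.
- by move=> A eA; have [] := h1 A (DE A eA).
- by move=> A t eA t0; rewrite h4//; exact: DE.
move=> A e eA e0.
have [|U [[_ oU] hU]] := h2 [set p | Sigma p.1 /\ `|p.2 - (h A).2| < e].
  move=> p [p1 p2]; exists (@Sigma R), [set x | `|x - (h A).2| < e]; split => //.
    split => //; exists (@isClass R); split; first by split => // B cB; exists 1.
    by move=> B eB; split => [_|_]; [exists B|exact: eB.1].
  exact: ropen_interval.
have UA : U A.
  apply/(hU A (DE A eA)); split; last by rewrite subrr normr0.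
  by rewrite h3; [exists A|exact: DE].
have [r r0 hr] := oU A UA; exists r => // B eB hB.
by have [] := (hU B (DE B eB)).1 (hr B eB.1 hB).
Qed.

Lemma Estar_cls (X : mmspace R) : ~ is_point X -> Estar (cls X).
Proof.
move=> nX; split; first exact: isClass_cls.
move=> [Y [XY pY]]; apply: nX; move: (mm_iso_sym XY); rewrite mm_isoE => YX.
exact: is_point_scaled YX pY.
Qed.

(** [Z] has masses 1/2 and 1/2, [W] has masses q and 1 - q, [Y] is the three-point space and [Y'] is
    [Y] scaled by 1/L. [Y] is near [Z] uniformly in [L], and [Y'] is near [W] for large [L], which
    is chosen last. *)
Lemma bundle_nontrivial : ~ trivial_bundle delta.
Proof.
move=> /trivial_bundle_section[F [F0 FM Fc]].
have [||| Z [f [fZ nZ mZ]]] := @two_space 2 (fun i => i == 0%N) (fun=> 2^-1).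
- by move=> [|]; [exists 0%N|exists 1%N].
- by move=> _; lra.
- by rewrite !big_ord_recl big_ord0; lra.
have eZ := Estar_cls nZ; have FZ := F0 _ eZ.
have [r r0 hr] := Fc _ _ eZ FZ.
(* Below [r] for closeness to [Z], below 1/2 for positive weights. *)
pose q := Num.min r 2^-1 / 2.
have m0 : 0 < Num.min r 2^-1 by rewrite lt_min r0; lra.
have m1 : Num.min r 2^-1 <= r by rewrite ge_min lexx.
have m2 : Num.min r 2^-1 <= 2^-1 by rewrite ge_min lexx orbT.
have q0 : 0 < q by rewrite /q; lra.
have qr : q < r by rewrite /q; lra.
have hq : 0 < q < 2^-1 by rewrite /q; apply/andP; split; lra.
have [||| W [g [gW nW mW]]] :=
    @two_space 3 (fun i => i == 0%N) (three_weight q).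
- by move=> [|]; [exists 0%N|exists 1%N].
- by move=> i; exact: three_weight_gt0.
- exact: three_weight_sum.
have eW := Estar_cls nW; have FW := F0 _ eW.
have FW2 : 0 < F (cls W) / 2 by lra.
have [r' r'0 hr'] := Fc _ _ eW FW2.
(* The summands give, in turn, [1 <= L], [L^-1 < r'] and [4 * F (cls Z) < L * F (cls W)]. *)
pose L := 1 + r'^-1 + 4 * F (cls Z) / F (cls W).
have r'i : 0 < r'^-1 by rewrite invr_gt0.
have FZW : 0 < 4 * F (cls Z) / F (cls W) by rewrite divr_gt0 ?mulr_gt0//.
have L1 : 1 <= L by rewrite /L; lra.
have L0 : 0 < L by lra.
have Lr' : L^-1 < r'.
  by rewrite invf_plt ?posrE// /L; lra.
have LF : 4 * F (cls Z) < L * F (cls W).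
  by rewrite -ltr_pdivrMr// /L; lra.
have [Y [k [kY nY bY mY]]] := three_space hq L1.
have [phi pphi] := param_exists Y.
(* [fZY] merges the far point with [true]; [gWY] merges the two near points. *)
pose fZY y := f (odflt true (k y)).
pose gWY y := g (k y == None).
have pZ : param (fZY \o phi).
  apply: param_map => // B _; rewrite mZ.
  have -> : fZY @^-1` B = k @^-1` [set x | B (f (odflt true x))] by [].
  rewrite mY /fin_meas !big_ord_recl !big_ord0 /=.
  by do 2 case: asboolP => _; lra.
have pW : param (gWY \o phi).
  apply: param_map => // B _; rewrite mW.
  have -> : gWY @^-1` B = k @^-1` [set x | B (g (x == None))] by [].
  by rewrite mY /fin_meas; apply: eq_bigr => -[[|[|[|i]]] hi] _.
have dZY : delta Z Y <= q.
  apply: (admissible_box adm (ltW q0) pZ pphi).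
  have [mI lI] := pphi [set y | k y != None] (bY _).
  (* Away from the far point, of mass [q], distances agree exactly. *)
  exists (@I01 R `&` phi @^-1` [set y | k y != None]); split.
  - by split => // t [].
  - rewrite lI lee_fin -[X in mmeas X]/(k @^-1` [set x | x != None]) mY /fin_meas.
    by rewrite !big_ord_recl big_ord0 /= asboolF ?asboolT//; lra.
  - move=> s t [_ /= ks] [_ /= kt]; rewrite kY fZ.
    by case: (k (phi s)) ks => // a _; case: (k (phi t)) kt => // b _; rewrite subrr normr0 ltW.
have eY := Estar_cls nY.
have FY : F (cls Y) < 2 * F (cls Z).
  have := hr _ eY (le_lt_trans (clsdist_le adm (mem_cls Z) (mem_cls Y)) (le_lt_trans dZY qr)).
  by rewrite ltr_norml => /andP[_]; lra.
have Li0 : 0 < L^-1 by rewrite invr_gt0.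
have [Y' LY'] := scale_exists Y Li0.
have dWY' : delta W Y' <= L^-1.
  case: (LY') => [u [u1 [u2 u3]]].
  have pY' := param_scaled (ltW Li0) u2 u3 pphi.
  apply: (admissible_box adm (ltW Li0) pW pY').
  (* No time is discarded: only the near pair is distorted, its distance 1/L being compared with
     0. *)
  exists (@I01 R); split; first by split => //; exact: measurable_I01.
    by rewrite leb_I01 lee_fin; lra.
  move=> s t _ _; rewrite /= u2 kY gW /gWY /two_dist.
  case: (k (phi s)) => [a|]; case: (k (phi t)) => [b|] //=.
  - rewrite /two_dist sub0r normrN; case: (a != b).
      by rewrite mulr1 gtr0_norm.
    by rewrite mulr0 normr0 ltW.
  - by rewrite mulVf ?gt_eqF// subrr normr0 ltW.
  - by rewrite mulVf ?gt_eqF// subrr normr0 ltW.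
  - by rewrite mulr0 subrr normr0 ltW.
have eY' : Estar (cls Y') by rewrite -(actC_cls Li0 LY'); exact: Estar_act.
have := hr' _ eY' (le_lt_trans (clsdist_le adm (mem_cls W) (mem_cls Y')) (le_lt_trans dWY' Lr')).
(* The contradiction: F(W)/2 < F(Y') = F(Y)/L < 2 F(Z)/L < F(W)/2. *)
rewrite -(actC_cls Li0 LY') FM// ltr_norml => /andP[h _].
have {}h : F (cls W) / 2 < L^-1 * F (cls Y) by lra.
by move: h; rewrite ltr_pdivlMl//; lra.
Qed.

End Nontrivial.

Theorem theorem1p2 (R : realType) :
  nontrivial_loc_trivial_principal_bundle (@boxdist R) /\
  nontrivial_loc_trivial_principal_bundle (@concdist R).
Proof.
suff h delta : @admissible R delta -> nontrivial_loc_trivial_principal_bundle delta.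
  by split; apply: h; [exact: box_admissible|exact: conc_admissible].
move=> adm; split; [split| |].
- exact: bundle_free.
- exact: bundle_translation.
- exact: bundle_locally_trivial.
- exact: bundle_nontrivial.
Qed.
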